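(* Let $K:\mathbb{Z}^2\to[0,\infty)$ satisfy $\sup_{k,l\in\mathbb{Z}}K(k,l)\le C_K$ for some $C_K\in(0,\infty)$, and let $Q$ be the associated collision operator. Let $f_0\in\ell_{1,1}(\mathbb{Z})$ with $f_0(k)\ge0$ for all $k\in\mathbb{Z}$. Then the initial value problem $\dot f(t)=Q(f(t))$, $t>0$, $f(0)=f_0$, possesses a unique $\ell_{1,1}(\mathbb{Z})$-solution $f$, which exists for all $t\ge0$, is nonnegative (i.e. $f(t)(k)\ge0$ for all $t\ge0$, $k\in\mathbb{Z}$), and satisfies $m(f(t))=m(f_0)$ and $q(f(t))=q(f_0)$ for all $t\in[0,\infty)$.
   Context: $\ell_1(\mathbb{Z})$ is the Banach space of real functions $g:\mathbb{Z}\to\mathbb{R}$ with $\|g\|_1=\sum_{k\in\mathbb{Z}}|g(k)|<\infty$; $\ell_{1,1}(\mathbb{Z})=\{g\in\ell_1(\mathbb{Z}):\|g\|_{1,1}:=\sum_{k\in\mathbb{Z}}(1+|k|)|g(k)|<\infty\}$. Total mass: $m(g)=\sum_{k\in\mathbb{Z}}g(k)$. Total charge: $q(g)=\sum_{k\in\mathbb{Z}}k\,g(k)$. The collision operator associated with $K$ is $Q(f)=Q(f,f)$, where for $k\in\mathbb{Z}$ $$Q(f,g)(k)=\sum_{l\in\mathbb{Z}}\Big(K(l,k-1)g(l)f(k-1)-K(k,l-1)f(k)g(l-1)-K(l,k)g(l)f(k)+K(k+1,l-1)f(k+1)g(l-1)\Big).$$ For bounded $K$, $Q$ maps $\ell_{1,1}(\mathbb{Z})$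 into itself. An $\ell_{1,1}(\mathbb{Z})$-solution on $[0,\infty)$ is a function $f\in C^1([0,\infty);\ell_{1,1}(\mathbb{Z}))$ satisfying the initial value problem. *)

(* Defs.v *)
From HB Require Import structures.
From mathcomp Require Import all_boot all_order all_algebra.
From mathcomp Require Import all_classical all_reals all_analysis.

Set Implicit Arguments.
Unset Strict Implicit.
Unset Printing Implicit Defensive.
Import Order.TTheory GRing.Theory Num.Theory.
Import numFieldNormedType.Exports.
Local Open Scope classical_set_scope.
Local Open Scope ring_scope.

(** Sum over [int] of an absolutely summable family: the sum of its positive
    part minus the sum of its negative part (a junk value if the family is not
    absolutely summable). *)
Definition zsum (R : realType) (g : int -> R) : R :=
  fine (\esum_(k in [set: int]) (EFin \o g)^\+%E k
        - \esum_(k in [set: int]) (EFin \o g)^\-%E k)%E.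

Definition enorm11 (R : realType) (g : int -> R) : \bar R :=
  \esum_(k in [set: int]) ((1 + `|k|%:~R) * `|g k|)%:E.

Section enorm11_theory.
Variable R : realType.
Implicit Types f g : int -> R.

Let weighted_ge0 g (k : int) : (0 <= ((1 + `|k|%:~R) * `|g k|)%:E :> \bar R)%E.
Proof. by rewrite lee_fin mulr_ge0// addr_ge0// ler0z. Qed.

Lemma enorm11_ge0 g : (0 <= enorm11 g)%E.
Proof. by apply: esum_ge0 => k _; exact: weighted_ge0. Qed.

Lemma enorm11D f g : (enorm11 (f + g)%R <= enorm11 f + enorm11 g)%E.
Proof.
rewrite /enorm11 -esumD; [|by move=> k _; exact: weighted_ge0..].
apply: le_esum => k _; rewrite -EFinD lee_fin -mulrDr ler_wpM2l ?ler_normD//.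
Qed.

Lemma enorm11Z (a : R) g : enorm11 (a *: g)%R = (`|a|%:E * enorm11 g)%E.
Proof.
rewrite /enorm11 /esum -ereal_supZl//; last first.
  apply/set0P; exists 0%E, set0; first exact: fsets_set0.
  by rewrite fsbig_set0.
rewrite image_comp; congr ereal_sup; apply: eq_imagel => /= A [finA _].
rewrite ge0_mule_fsumr//; apply: eq_fsbigr => k _.
by rewrite -EFinM normrM mulrCA.
Qed.

Lemma enorm11_eq0 g : enorm11 g = 0%E -> g = 0.
Proof.
move=> g0; apply/funext => k; apply/eqP; rewrite -normr_le0.
have : (((1 + `|k|%:~R) * `|g k|)%:E <= enorm11 g)%E.
  apply: esum_ge; exists [set k]; first by split.
  by rewrite fsbig_set1.
by rewrite g0 lee_fin pmulr_rle0// ltr_pwDl// ler0z.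
Qed.

(** Since [1 <= 1 + |k|], a finite [enorm11] already implies summability. *)
Definition l11_pred : {pred int -> R} :=
  mem [set g : int -> R | (enorm11 g < +oo)%E].

Lemma l11_submod_closed : submod_closed l11_pred.
Proof.
split=> [|a f g]; rewrite !inE /=.
  by rewrite /enorm11 esum1// => k _; rewrite normr0 mulr0.
move=> foo goo; apply: le_lt_trans (enorm11D _ _) _.
rewrite lte_add_pinfty// enorm11Z lte_mul_pinfty//.
Qed.

HB.instance Definition _ :=
  GRing.isSubmodClosed.Build R (int -> R) l11_pred l11_submod_closed.

End enorm11_theory.

(** The normed space of functions [g : int -> R] with finite [enorm11 g]. *)
Record l11 (R : realType) := L11 {
  l11_fun :> int -> R ;
  l11_funP : l11_fun \in @l11_pred R }.

Section l11_normed.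
Variable R : realType.

HB.instance Definition _ := [isSub for @l11_fun R].
HB.instance Definition _ := [Choice of l11 R by <:].
HB.instance Definition _ := [SubChoice_isSubLmodule of l11 R by <:].

Definition norm11 (g : l11 R) : R := fine (enorm11 g).

Let enorm11_fin (g : l11 R) : enorm11 g \is a fin_num.
Proof. by rewrite ge0_fin_numE ?enorm11_ge0//; have := l11_funP g; rewrite inE. Qed.

Let norm11D (f g : l11 R) : norm11 (f + g) <= norm11 f + norm11 g.
Proof.
rewrite -fineD//; apply: fine_le => //; first by rewrite fin_numD !enorm11_fin.
exact: enorm11D.
Qed.

Let norm11Z (a : R) (g : l11 R) : norm11 (a *: g) = `|a| * norm11 g.
Proof. by rewrite /norm11 enorm11Z fineM// enorm11_fin. Qed.

Let norm11_eq0 (g : l11 R) : norm11 g = 0 -> g = 0.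
Proof.
move=> g0; apply/val_inj/enorm11_eq0.
by rewrite -(fineK (enorm11_fin g)) -/(norm11 g) g0.
Qed.

HB.instance Definition _ :=
  Lmodule_isNormed.Build R (l11 R) norm11D norm11Z norm11_eq0.

End l11_normed.

Definition total_mass (R : realType) (g : int -> R) : R := zsum g.

Definition total_charge (R : realType) (g : int -> R) : R :=
  zsum (fun k => k%:~R * g k).

Definition collision2 (R : realType) (K : int -> int -> R) (f g : int -> R) :
    int -> R :=
  fun k => zsum (fun l =>
    K l (k - 1) * g l * f (k - 1) - K k (l - 1) * f k * g (l - 1)
    - K l k * g l * f k + K (k + 1) (l - 1) * f (k + 1) * g (l - 1)).

Definition collision (R : realType) (K : int -> int -> R) (f : int -> R) :
  int -> R := collision2 K f f.

(** [f] is continuously differentiable on [0, +oo[, with derivative [df]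
    (one-sided at [0]); values at negative arguments play no role. *)
Definition is_C1_derivative (R : realType) (V : normedModType R)
    (f df : R -> V) : Prop :=
  [/\ forall t : R, 0 < t -> is_derive t 1 f (df t),
      h^-1 *: (f h - f 0) @[h --> 0^'+] --> df 0
    & {within `[0, +oo[, continuous df}].

Definition is_l11_solution (R : realType) (K : int -> int -> R) (f0 : l11 R)
    (f : R -> l11 R) : Prop :=
  exists df : R -> l11 R,
    [/\ is_C1_derivative f df,
        forall t : R, 0 < t -> df t = collision K (f t) :> (int -> R)
      & f 0 = f0].

(* Main.v *)
Require Import Defs.
From HB Require Import structures.
From mathcomp Require Import all_boot all_order all_algebra.
From mathcomp Require Import all_classical all_reals all_analysis.
From mathcomp Require Import ring lra zify.
From mathcomp Require finmap.

Set Implicit Arguments.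
Unset Strict Implicit.
Unset Printing Implicit Defensive.
Import Order.TTheory GRing.Theory Num.Theory.
Import numFieldNormedType.Exports.
Local Open Scope classical_set_scope.
Local Open Scope ring_scope.

(** Existence is obtained from a Wild sum.  Mass is conserved, so with
    [m = m(f0)] and [lam = 2 CK m] the equation reads [f' + lam f = P(f, f)],
    where [P(f, g) = Q(f, g) + 2 CK m(g) f] is bilinear and maps nonnegative
    functions to nonnegative ones.  The ansatz
    [f(t) = e^(-lam t) sum_n (1 - e^(-lam t))^n b_n] solves it when [b_0 = f0] and
    [b_(n+1) = (sum_(i <= n) P(b_i, b_(n-i))) / ((n + 1) lam)].  All [b_n] are
    nonnegative with the mass and the charge of [f0], and their norms grow at most
    linearly in [n], so the series converges for every [t >= 0].  Uniqueness among
    all solutions is a Gronwall argument, since [Q] is locally Lipschitz. *)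

(** * Summation over the integers *)

(** A contraction argument for [Q] gives only a local solution and says nothing about its sign. The
    damping term [lam f] absorbs the negative terms: each of the two jump rates out of a site is at
    most [CK * m], hence the 2 in [lam]. The general norm bound on [P] would only give geometric
    growth of the [b_n], and so convergence for small [t] alone. On nonnegative arguments the second
    factor enters the bound only through its mass, and after division by [lam] a product exceeds the
    norm of its first factor by at most [m]. This makes the growth linear, so the series converges
    for every [s = 1 - e^(-lam t)] in [[0, 1)]. [Q(f, g)] has zero mass for all [f], [g], whereas
    its charge cancels only when [Q(b_i, b_j)] and [Q(b_j, b_i)] are added. If [m = 0], the division
    by [lam] breaks down, but then the solution is constantly zero. *)

Section zsum_theory.
Variable R : realType.
Implicit Types f g h : int -> R.

Definition zsummable g : Prop := summable [set: int] (EFin \o g).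

Lemma zsummable_le g h : (forall k, `|g k| <= `|h k|) ->
  zsummable h -> zsummable g.
Proof.
move=> gh; apply: le_lt_trans; apply: le_esum => k _.
by rewrite /= lee_fin.
Qed.

Lemma zsummableD g h : zsummable g -> zsummable h ->
  zsummable (fun k => g k + h k).
Proof. exact: summableD. Qed.

Lemma zsummableN g : zsummable g -> zsummable (fun k => - g k).
Proof. by apply: zsummable_le => k; rewrite normrN. Qed.

Lemma zsummableB g h : zsummable g -> zsummable h ->
  zsummable (fun k => g k - h k).
Proof. by move=> sg sh; apply: zsummableD => //; exact: zsummableN. Qed.

Lemma esumZ (c : R) (g : int -> \bar R) : 0 <= c -> (forall k, 0 <= g k)%E ->
  (\esum_(k in [set: int]) (c%:E * g k) = c%:E * \esum_(k in [set: int]) g k)%E.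
Proof.
move=> c0 g0; rewrite /esum -ereal_supZl//; last first.
  by apply/set0P; exists 0%E, set0; [exact: fsets_set0|rewrite fsbig_set0].
rewrite image_comp; congr ereal_sup; apply: eq_imagel => /= A [finA _].
by rewrite ge0_mule_fsumr.
Qed.

Lemma zsummable_mul (c g : int -> R) (C : R) : (forall k, `|c k| <= C) ->
  zsummable g -> zsummable (fun k => c k * g k).
Proof.
move=> cC sg; have C0 : 0 <= C by apply: le_trans (cC 0).
apply: (@le_lt_trans _ _ (C%:E * \esum_(k in [set: int]) `|g k|%:E)%E).
  rewrite -esumZ//.
  by apply: le_esum => k _; rewrite /= -EFinM lee_fin normrM ler_wpM2r.
by rewrite lte_mul_pinfty// ge0_fin_numE// esum_ge0.
Qed.

Lemma zsummableZ (c : R) g : zsummable g -> zsummable (fun k => c * g k).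
Proof. by apply: (@zsummable_mul (fun=> c)) => k; exact: lexx. Qed.

Lemma shift_bij (a : int) : set_bij [set: int] [set: int] (fun k => k + a).
Proof.
split => //; first by move=> x y _ _ /addIr.
by move=> x _; exists (x - a) => //=; rewrite subrK.
Qed.

Lemma esum_shift (a : int) (g : int -> \bar R) :
  \esum_(k in [set: int]) g (k + a) = \esum_(k in [set: int]) g k.
Proof. by rewrite [RHS](@reindex_esum _ _ _ _ _ _ g (shift_bij a)). Qed.

Lemma zsummable_shift (a : int) g :
  zsummable g -> zsummable (fun k => g (k + a)).
Proof.
move=> sg; rewrite /zsummable /summable.
by have -> := esum_shift a (fun k => `|(EFin \o g) k|%E).
Qed.

Lemma zsum_shift (a : int) g : zsum (fun k => g (k + a)) = zsum g.
Proof.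
rewrite /zsum; congr (fine (_ - _)); rewrite -[RHS](esum_shift a).
  by apply: eq_esum => k _; rewrite !funeposE.
by apply: eq_esum => k _; rewrite !funenegE.
Qed.

Lemma zsummable_fin g : zsummable g -> (forall k, 0 <= g k) ->
  \esum_(k in [set: int]) (g k)%:E \is a fin_num.
Proof.
move=> sg g0; rewrite ge0_fin_numE ?esum_ge0// => [|k _]; last by rewrite lee_fin.
apply: le_lt_trans sg; apply: le_esum => k _.
by rewrite /= lee_fin ler_norm.
Qed.

(** Any splitting into nonnegative summable families computes [zsum], not only the positive and
    negative parts of its definition. Additivity rests on this, since the positive part of a sum is
    not the sum of the positive parts. *)
Lemma zsumB_ge0 g h : zsummable g -> zsummable h ->
  (forall k, 0 <= g k) -> (forall k, 0 <= h k) ->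
  zsum (fun k => g k - h k) =
  fine (\esum_(k in [set: int]) (g k)%:E) -
  fine (\esum_(k in [set: int]) (h k)%:E).
Proof.
move=> sg sh g0 h0; rewrite -fineB ?zsummable_fin//; congr fine.
have := @esumB R int setT (EFin \o g) (EFin \o h) sg sh.
by apply => k _; rewrite lee_fin.
Qed.

Lemma zsum_ge0E g : zsummable g -> (forall k, 0 <= g k) ->
  zsum g = fine (\esum_(k in [set: int]) (g k)%:E).
Proof.
move=> sg g0; rewrite -[LHS]/(zsum (fun k => g k)).
under [fun k => _]funext do rewrite -[g _]subr0.
rewrite zsumB_ge0//; last by rewrite /zsummable /summable esum1// => k _; rewrite /= normr0.
by rewrite [X in _ - fine X]esum1 ?subr0.
Qed.

Lemma EFin_zsum g : zsummable g -> (forall k, 0 <= g k) ->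
  (zsum g)%:E = \esum_(k in [set: int]) (g k)%:E.
Proof. by move=> sg g0; rewrite zsum_ge0E// fineK// zsummable_fin. Qed.

Lemma zsum_ge0 g : (forall k, 0 <= g k) -> 0 <= zsum g.
Proof.
move=> g0; rewrite /zsum [X in (_ - X)%E]esum1 ?sube0; last first.
  move=> k _; rewrite funenegE /=; apply/max_idPr.
  by rewrite lee_fin oppr_le0.
by apply: fine_ge0; apply: esum_ge0 => k _; rewrite funeposE le_max lexx orbT.
Qed.

Let pp g := fun k => Num.max (g k) 0.
Let np g := fun k => Num.max (- g k) 0.

Let ppE g k : g k = pp g k - np g k.
Proof. by rewrite /pp /np; case: (leP (g k) 0); case: (leP (- g k) 0); lra. Qed.

Let pp_sum g : zsummable g -> zsummable (pp g).
Proof.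
apply: zsummable_le => k; rewrite /pp; case: (leP (g k) 0) => //.
by rewrite normr0.
Qed.

Let np_sum g : zsummable g -> zsummable (np g).
Proof.
apply: zsummable_le => k; rewrite /np; case: (leP (- g k) 0) => //.
  by rewrite normr0.
by rewrite normrN.
Qed.

Let pp_ge0 g k : 0 <= pp g k. Proof. by rewrite le_max lexx orbT. Qed.
Let np_ge0 g k : 0 <= np g k. Proof. by rewrite le_max lexx orbT. Qed.

Lemma zsumD g h : zsummable g -> zsummable h ->
  zsum (fun k => g k + h k) = zsum g + zsum h.
Proof.
move=> sg sh.
have -> : (fun k => g k + h k) =
    (fun k => (pp g k + pp h k) - (np g k + np h k)).
  by apply/funext => k; rewrite [g k in LHS]ppE [h k in LHS]ppE; ring.
have zE u : zsummable u -> zsum u = zsum (pp u) - zsum (np u).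
  move=> su; rewrite [in LHS](_ : u = fun k => pp u k - np u k); last first.
    by apply/funext => k; exact: ppE.
  rewrite zsumB_ge0 ?zsum_ge0E//; by [exact: pp_sum|exact: np_sum].
rewrite [zsum g]zE// [zsum h]zE//.
have spg := pp_sum sg; have sph := pp_sum sh.
have sng := np_sum sg; have snh := np_sum sh.
rewrite zsumB_ge0; [|exact: zsummableD|exact: zsummableD
  |by move=> k; rewrite addr_ge0|by move=> k; rewrite addr_ge0].
rewrite !zsum_ge0E//.
have eD u v : zsummable u -> zsummable v -> (forall k, 0 <= u k) ->
    (forall k, 0 <= v k) ->
    fine (\esum_(k in [set: int]) (u k + v k)%:E) =
    fine (\esum_(k in [set: int]) (u k)%:E)
    + fine (\esum_(k in [set: int]) (v k)%:E).
  move=> su sv u0 v0; rewrite -fineD ?zsummable_fin//.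
  by under eq_esum do rewrite EFinD; rewrite esumD// => k _; rewrite lee_fin.
rewrite (eD _ _ spg sph)// (eD _ _ sng snh)//.
by rewrite opprD addrACA.
Qed.

Lemma zsum0 : zsum (fun _ => 0 : R) = 0.
Proof.
rewrite zsum_ge0E//; last by rewrite /zsummable /summable esum1// => k _; rewrite /= normr0.
by rewrite esum1.
Qed.

Lemma zsumN g : zsummable g -> zsum (fun k => - g k) = - zsum g.
Proof.
move=> sg; apply/eqP; rewrite -addr_eq0 -zsumD//; last exact: zsummableN.
by under [fun k => _]funext do rewrite addNr; rewrite zsum0.
Qed.

Lemma zsumB g h : zsummable g -> zsummable h ->
  zsum (fun k => g k - h k) = zsum g - zsum h.
Proof.
by move=> sg sh; rewrite zsumD ?zsumN//; exact: zsummableN.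
Qed.

Lemma zsumZ (c : R) g : zsummable g -> zsum (fun k => c * g k) = c * zsum g.
Proof.
have ge0Z (d : R) u : zsummable u -> 0 <= d -> (forall k, 0 <= u k) ->
    zsum (fun k => d * u k) = d * zsum u.
  move=> su d0 u0; rewrite !zsum_ge0E//; first last.
  - by move=> k; rewrite mulr_ge0.
  - exact: zsummableZ.
  under eq_esum do rewrite EFinM.
  by rewrite esumZ// ?fineM ?zsummable_fin// => k; rewrite lee_fin.
have pZ (d : R) u : zsummable u -> 0 <= d ->
    zsum (fun k => d * u k) = d * zsum u.
  move=> su d0; have -> : u = (fun k => pp u k - np u k).
    by apply/funext => k; exact: ppE.
  have spg := pp_sum su; have sng := np_sum su.
  under [fun k => d * _]funext do rewrite mulrBr.
  rewrite !zsumB//; [|exact: zsummableZ|exact: zsummableZ].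
  by rewrite !ge0Z// mulrBr.
move=> sg; case: (leP 0 c) => c0; first exact: pZ.
have -> : (fun k => c * g k) = (fun k => - c * - g k).
  by apply/funext => k; rewrite mulrNN.
rewrite pZ ?zsumN ?mulrNN//; last by rewrite oppr_ge0 ltW.
exact: zsummableN.
Qed.

Lemma le_zsum g h : zsummable g -> zsummable h -> (forall k, g k <= h k) ->
  zsum g <= zsum h.
Proof.
move=> sg sh gh; rewrite -subr_ge0 -zsumB//; apply: zsum_ge0 => k.
by rewrite subr_ge0.
Qed.

Lemma ler_norm_zsum g : zsummable g -> `|zsum g| <= zsum (fun k => `|g k|).
Proof.
move=> sg; have sa : zsummable (fun k => `|g k|).
  by apply: zsummable_le sg => k; rewrite normr_id.
rewrite ler_norml -zsumN//; apply/andP; split; apply: le_zsum => //.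
- exact: zsummableN.
- by move=> k; rewrite lerNl -normrN ler_norm.
- by move=> k; rewrite ler_norm.
Qed.

Lemma zsum_eq0 g : zsummable g -> (forall k, 0 <= g k) -> zsum g = 0 ->
  forall k, g k = 0.
Proof.
move=> sg g0 zg k; apply/eqP; rewrite eq_le g0 andbT -lee_fin -zg EFin_zsum//.
by apply: esum_ge; exists [set k] => //; rewrite fsbig_set1.
Qed.

(** Tonelli: the exchange takes place among extended nonnegative sums, and the summability
    hypotheses translate it back to real ones. *)
Lemma zsum_exchange (a : int -> int -> R) :
  (forall i j, 0 <= a i j) ->
  (forall i, zsummable (a i)) -> (forall j, zsummable (a^~ j)) ->
  zsummable (fun i => zsum (a i)) -> zsummable (fun j => zsum (a^~ j)) ->
  zsum (fun i => zsum (a i)) = zsum (fun j => zsum (a^~ j)).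
Proof.
move=> a0 sr sc sR sC.
rewrite !zsum_ge0E//; [|by move=> j; exact: zsum_ge0..].
under eq_esum do rewrite EFin_zsum//.
under [in RHS]eq_esum do rewrite EFin_zsum//.
congr fine; rewrite !esum_esum//; [|by move=> *; rewrite lee_fin..].
rewrite (@reindex_esum _ _ _ ([set: int] `*`` (fun=> [set: int])) _
  (fun k => (k.2, k.1)))//.
by split => //= [[? ?] [? ?] _ _ [-> ->]|[i j] _]; [|exists (j, i)].
Qed.

End zsum_theory.

(** * The Banach space [l11] *)

Lemma continuous_linear_le (R : realType) (V W : normedModType R)
    (l : {linear V -> W}) (C : R) :
  (forall v, `|l v| <= C * `|v|) -> continuous l.
Proof.
move=> lC; apply: bounded_linear_continuous; apply/bounded_funP => r.
exists (`|C| * r) => x xr; apply: le_trans (lC x) _.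
apply: le_trans (ler_wpM2l (normr_ge0 C) xr).
by apply: ler_wpM2r => //; exact: ler_norm.
Qed.

Section l11_theory.
Variable R : realType.
Implicit Types f g : l11 R.

Lemma weight_ge1 (k : int) : 1 <= 1 + `|k|%:~R :> R.
Proof. by rewrite lerDl ler0z. Qed.

Lemma weight_ge0 (k : int) : 0 <= 1 + `|k|%:~R :> R.
Proof. exact: le_trans ler01 (weight_ge1 k). Qed.

Lemma l11_predP (g : int -> R) : g \in @l11_pred R <->
  zsummable (fun k => (1 + `|k|%:~R) * g k).
Proof.
rewrite inE /= /enorm11 /zsummable /summable.
rewrite (_ : (fun k => _) = fun k => `|((1 + `|k|%:~R) * g k)%:E|%E)//.
by apply/funext => k; rewrite /= normrM (ger0_norm (weight_ge0 k)).
Qed.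

Lemma l11_weighted f : zsummable (fun k => (1 + `|k|%:~R) * f k).
Proof. exact/l11_predP/l11_funP. Qed.

Lemma l11_summable f : zsummable f.
Proof.
apply: zsummable_le (l11_weighted f) => k.
by rewrite normrM (ger0_norm (weight_ge0 k)) ler_peMl// weight_ge1.
Qed.

Lemma l11_moment f : zsummable (fun k => k%:~R * f k).
Proof.
apply: zsummable_le (l11_weighted f) => k.
rewrite !normrM (ger0_norm (weight_ge0 k)) ler_wpM2r//.
by rewrite intr_norm lerDr.
Qed.

Lemma zsummable_norm (g : int -> R) : zsummable g -> zsummable (fun k => `|g k|).
Proof. by apply: zsummable_le => k; rewrite normr_id. Qed.

Lemma l11_weighted_norm f : zsummable (fun k => (1 + `|k|%:~R) * `|f k|).
Proof.
apply: zsummable_le (l11_weighted f) => k.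
by rewrite !normrM normr_id.
Qed.

Lemma l11_normE f : `|f| = zsum (fun k => (1 + `|k|%:~R) * `|f k|).
Proof.
by rewrite zsum_ge0E//; exact: l11_weighted_norm.
Qed.

Lemma enorm11E f : enorm11 f = `|f|%:E.
Proof.
by rewrite l11_normE EFin_zsum//; exact: l11_weighted_norm.
Qed.

Lemma l11_norm_ge0E f : (forall k, 0 <= f k) ->
  `|f| = zsum (fun k => (1 + `|k|%:~R) * f k).
Proof.
move=> f0; rewrite l11_normE; congr zsum; apply/funext => k; congr (_ * _).
exact: ger0_norm.
Qed.

Lemma fin_sum_le_l11_norm f (s : seq int) : uniq s ->
  \sum_(k <- s) (1 + `|k|%:~R) * `|f k| <= `|f|.
Proof.
move=> us; rewrite -lee_fin -enorm11E; apply: esum_ge.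
exists [set` s]; first by split => //; exact: finite_seq.
by rewrite -sumEFin -fsbig_seq.
Qed.

(** The norm is a supremum of finite weighted sums. In this form estimates survive coordinatewise
    limits, which serves completeness, and can be tested by finitely supported functionals. *)
Lemma l11_norm_le f (C : R) :
  (forall s : seq int, uniq s -> \sum_(k <- s) (1 + `|k|%:~R) * `|f k| <= C) ->
  `|f| <= C.
Proof.
move=> H; rewrite -lee_fin -enorm11E; apply: ge_ereal_sup => _ [A [fA _] <-].
by rewrite fsbig_finite//= sumEFin lee_fin; apply: H; exact: finmap.fset_uniq.
Qed.

Lemma zsum_norm_le f : zsum (fun k => `|f k|) <= `|f|.
Proof.
rewrite l11_normE; apply: le_zsum; [|exact: l11_weighted_norm|].
  exact/zsummable_norm/l11_summable.
by move=> k; rewrite ler_peMl// weight_ge1.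
Qed.

Definition coord (k : int) f : R := f k.

Lemma coord_linear k : linear (coord k).
Proof. by []. Qed.

HB.instance Definition _ k :=
  GRing.isLinear.Build R (l11 R) R _ (coord k) (coord_linear k).

Lemma coord_le k f : `|coord k f| <= `|f|.
Proof.
have := @fin_sum_le_l11_norm f [:: k] isT; rewrite big_seq1.
by apply: le_trans; rewrite ler_peMl// weight_ge1.
Qed.

Lemma coord_continuous k : continuous (coord k).
Proof. by apply: (@continuous_linear_le _ _ _ _ 1) => f; rewrite mul1r coord_le. Qed.

Definition l11_mass f : R := zsum f.

Lemma mass_linear : linear l11_mass.
Proof.
move=> a f g; rewrite /l11_mass.
have -> : (a *: f + g : l11 R) = (fun k => a * f k + g k) :> (int -> R) by [].
rewrite zsumD; [|exact/zsummableZ/l11_summable|exact: l11_summable].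
by rewrite zsumZ//; exact: l11_summable.
Qed.

HB.instance Definition _ :=
  GRing.isLinear.Build R (l11 R) R _ l11_mass mass_linear.

Lemma mass_le f : `|l11_mass f| <= `|f|.
Proof.
apply: le_trans (zsum_norm_le f); exact/ler_norm_zsum/l11_summable.
Qed.

Lemma mass_continuous : continuous l11_mass.
Proof. by apply: (@continuous_linear_le _ _ _ _ 1) => f; rewrite mul1r mass_le. Qed.

Definition l11_charge f : R := zsum (fun k => k%:~R * f k).

Lemma charge_linear : linear l11_charge.
Proof.
move=> a f g; rewrite /l11_charge.
have -> : (fun k => k%:~R * (a *: f + g) k) =
    (fun k => a * (k%:~R * f k) + k%:~R * g k).
  by apply/funext => k; rewrite -[(a *: f + g) k]/(a * f k + g k); ring.
rewrite zsumD; [|exact/zsummableZ/l11_moment|exact: l11_moment].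
by rewrite zsumZ//; exact: l11_moment.
Qed.

HB.instance Definition _ :=
  GRing.isLinear.Build R (l11 R) R _ l11_charge charge_linear.

Lemma charge_le f : `|l11_charge f| <= `|f|.
Proof.
apply: le_trans (ler_norm_zsum (l11_moment f)) _.
rewrite l11_normE; apply: le_zsum; [|exact: l11_weighted_norm|].
  exact/zsummable_norm/l11_moment.
move=> k; rewrite normrM ler_wpM2r// intr_norm.
by rewrite lerDr.
Qed.

Lemma charge_continuous : continuous l11_charge.
Proof. by apply: (@continuous_linear_le _ _ _ _ 1) => f; rewrite mul1r charge_le. Qed.

Lemma l11_complete (F : set_system (l11 R)) :
  ProperFilter F -> cauchy F -> cvg F.
Proof.
move=> FF /cauchyP Fc.
have coord_cvg k : cvg (coord k @ F).
  apply/cauchy_cvgP/cauchyP => e e0; have [x Fx] := Fc _ e0.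
  exists (coord k x).
  change (F (fun y => ball (coord k x) e (coord k y))).
  apply: filterS Fx => y.
  rewrite -!ball_normE /= => xy; apply: le_lt_trans xy.
  exact: (coord_le k (x - y)).
pose h k := lim (coord k @ F).
(* A Fatou argument: only finitely many coordinates pass to the limit, and the bound [e] is uniform
   in [s]. *)
have close x e : F (ball x e) -> forall s : seq int, uniq s ->
    \sum_(k <- s) (1 + `|k|%:~R) * `|h k - x k| <= e.
  move=> Fx s us.
  have cv : (fun y : l11 R => \sum_(k <- s) (1 + `|k|%:~R) * `|coord k y - x k|)
      @ F --> \sum_(k <- s) (1 + `|k|%:~R) * `|h k - x k|.
    apply: cvg_big; [exact: add_continuous|] => k _; apply: cvgMl_tmp; apply: cvg_norm.
    by apply: cvgB; [exact: coord_cvg|exact: cvg_cst].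
  apply: cvgr_to_le cv _; apply: filterS Fx => y; rewrite -ball_normE /= distrC => /ltW.
  by apply: le_trans; exact: (@fin_sum_le_l11_norm (y - x)).
have hP : h \in @l11_pred R.
  have [x Fx] := Fc _ ltr01.
  have hx : (h - x)%R \in @l11_pred R.
    rewrite inE /=; apply: (@le_lt_trans _ _ 1%:E); last exact: ltry.
    apply: ge_ereal_sup => _ [A [fA _] <-].
    by rewrite fsbig_finite//= sumEFin lee_fin; exact/close/finmap.fset_uniq.
  (* The limit [h] is a perturbation of finite norm of an element [x] of the space. *)
  by rewrite -(subrK (x : int -> R) h) rpredD// l11_funP.
apply/cvg_ex; exists (L11 hP); apply/cvgrPdist_lt => e e0.
have e20 : 0 < e / 2 by rewrite divr_gt0.
have [x Fx] := Fc _ e20; apply: filterS (Fx) => y.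
rewrite -ball_normE /= => xy.
rewrite -(subrK x (L11 hP)) -addrA [e]splitr.
apply: le_lt_trans (ler_normD _ _) _; apply: ler_ltD => //.
by apply: l11_norm_le => s us; exact: (close x).
Qed.

HB.instance Definition _ := Uniform_isComplete.Build (l11 R) l11_complete.

End l11_theory.

(** * The collision operator on [l11] *)

Section collision_operator.
Variables (R : realType) (K : int -> int -> R) (CK : R).
Hypothesis K_ge0 : forall k l : int, 0 <= K k l.
Hypothesis K_le : forall k l : int, K k l <= CK.
Implicit Types f g : l11 R.

Lemma l11_ext f g : (forall k, f k = g k) -> f = g.
Proof. by move=> fg; apply/val_inj/funext. Qed.

(** A total construction: outside the space it returns the default 0, so each use is paired with a
    proof of weighted summability. *)
Definition l11_of (u : int -> R) : l11 R := insubd (0 : l11 R) u.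

Lemma l11_ofE (u : int -> R) :
  zsummable (fun k => (1 + `|k|%:~R) * u k) -> l11_of u = u :> (int -> R).
Proof. by move=> /l11_predP uP; rewrite -[LHS]/(\val (l11_of u)) insubdK. Qed.

Lemma CK_ge0 : 0 <= CK.
Proof. exact: le_trans (K_ge0 0 0) (K_le 0 0). Qed.

Let normK k l : `|K k l| <= CK. Proof. by rewrite ger0_norm. Qed.

(* [gain g k] and [loss g k] are the rates of the jumps [k -> k + 1] and
   [k -> k - 1] of a particle colliding with the background [g]. *)
Definition gain g k := zsum (fun l => K l k * g l).
Definition loss g k := zsum (fun l => K k l * g l).

Let sgain g k : zsummable (fun l => K l k * g l).
Proof. by apply: zsummable_mul (l11_summable g) => l; exact: normK. Qed.

Let sloss g k : zsummable (fun l => K k l * g l).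
Proof. by apply: zsummable_mul (l11_summable g) => l; exact: normK. Qed.

Let rate_le (c : int -> R) g : (forall l, `|c l| <= CK) ->
  `|zsum (fun l => c l * g l)| <= CK * `|g|.
Proof.
move=> cC; have sc : zsummable (fun l => c l * g l).
  exact: zsummable_mul cC (l11_summable g).
apply: le_trans (ler_norm_zsum sc) _.
apply: (@le_trans _ _ (zsum (fun l => CK * `|g l|))).
  apply: le_zsum; [exact: zsummable_norm|exact/zsummableZ/zsummable_norm/l11_summable|].
  by move=> l; rewrite normrM ler_wpM2r.
rewrite zsumZ; last exact/zsummable_norm/l11_summable.
by rewrite ler_wpM2l ?CK_ge0// zsum_norm_le.
Qed.

Lemma gain_le g k : `|gain g k| <= CK * `|g|.
Proof. by apply: rate_le => l; exact: normK. Qed.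

Lemma loss_le g k : `|loss g k| <= CK * `|g|.
Proof. by apply: rate_le => l; exact: normK. Qed.

Lemma gain_linear k : linear (fun g => gain g k).
Proof.
move=> a f g; rewrite /gain.
have -> : (fun l => K l k * (a *: f + g) l) =
    (fun l => a * (K l k * f l) + K l k * g l).
  by apply/funext => l; rewrite -[(a *: f + g) l]/(a * f l + g l); ring.
by rewrite zsumD ?zsumZ//; exact: zsummableZ.
Qed.

Lemma loss_linear k : linear (fun g => loss g k).
Proof.
move=> a f g; rewrite /loss.
have -> : (fun l => K k l * (a *: f + g) l) =
    (fun l => a * (K k l * f l) + K k l * g l).
  by apply/funext => l; rewrite -[(a *: f + g) l]/(a * f l + g l); ring.
by rewrite zsumD ?zsumZ//; exact: zsummableZ.
Qed.

Lemma gain_ge0 g k : (forall l, 0 <= g l) -> 0 <= gain g k.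
Proof. by move=> g0; apply: zsum_ge0 => l; rewrite mulr_ge0. Qed.

Lemma loss_ge0 g k : (forall l, 0 <= g l) -> 0 <= loss g k.
Proof. by move=> g0; apply: zsum_ge0 => l; rewrite mulr_ge0. Qed.

Lemma gain_le_mass g k : (forall l, 0 <= g l) -> gain g k <= CK * l11_mass g.
Proof.
move=> g0; rewrite -zsumZ; last exact: l11_summable.
apply: le_zsum => //; first exact/zsummableZ/l11_summable.
by move=> l; rewrite ler_wpM2r.
Qed.

Lemma loss_le_mass g k : (forall l, 0 <= g l) -> loss g k <= CK * l11_mass g.
Proof.
move=> g0; rewrite -zsumZ; last exact: l11_summable.
apply: le_zsum => //; first exact/zsummableZ/l11_summable.
by move=> l; rewrite ler_wpM2r.
Qed.

(** Boundedness of [K] makes each of the four sums converge separately. Shifting [l - 1] to [l] then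
    exhibits two discrete differences, one for each jump direction. *)
Lemma collision2E f g k : collision2 K f g k =
  gain g (k - 1) * f (k - 1) - gain g k * f k
  + (loss g (k + 1) * f (k + 1) - loss g k * f k).
Proof.
rewrite /collision2.
have E (j : int) (c : int -> R) : zsummable c ->
    zsummable (fun l => c l * f j) /\ zsum (fun l => c l * f j) = zsum c * f j.
  move=> sc; have -> : (fun l => c l * f j) = (fun l => f j * c l).
    by apply/funext => l; rewrite mulrC.
  by split; [exact: zsummableZ|rewrite zsumZ// mulrC].
have [s1 e1] := E (k - 1) _ (sgain g (k - 1)).
have [s2 e2] := E k _ (zsummable_shift (- 1) (sloss g k)).
have [s3 e3] := E k _ (sgain g k).
have [s4 e4] := E (k + 1) _ (zsummable_shift (- 1) (sloss g (k + 1))).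
rewrite [LHS](_ : _ = zsum (fun l =>
   ((K l (k - 1) * g l * f (k - 1) - K k (l - 1) * g (l - 1) * f k)
   - K l k * g l * f k) + K (k + 1) (l - 1) * g (l - 1) * f (k + 1))); last first.
  by congr zsum; apply/funext => l; ring.
rewrite zsumD//; last by apply: zsummableB => //; exact: zsummableB.
rewrite zsumB//; last exact: zsummableB.
rewrite zsumB// e1 e2 e3 e4 -/(gain g (k - 1)) -/(gain g k).
rewrite (zsum_shift (-1) (fun l => K k l * g l)).
rewrite (zsum_shift (-1) (fun l => K (k + 1) l * g l)).
by rewrite -/(loss g k) -/(loss g (k + 1)); ring.
Qed.

Definition gainl g f : l11 R := l11_of (fun k => gain g k * f k).
Definition lossl g f : l11 R := l11_of (fun k => loss g k * f k).

Let wmul (c : int -> R) f (C : R) : (forall k, `|c k| <= C) ->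
  zsummable (fun k => (1 + `|k|%:~R) * (c k * f k)).
Proof.
move=> cC; have -> : (fun k => (1 + `|k|%:~R) * (c k * f k)) =
   (fun k => c k * ((1 + `|k|%:~R) * f k)) by apply/funext => k; rewrite mulrCA.
exact: zsummable_mul cC (l11_weighted f).
Qed.

Lemma gainlE g f k : gainl g f k = gain g k * f k.
Proof. by rewrite /gainl l11_ofE//; apply: wmul; exact: gain_le. Qed.

Lemma losslE g f k : lossl g f k = loss g k * f k.
Proof. by rewrite /lossl l11_ofE//; apply: wmul; exact: loss_le. Qed.

Let norm_mul (u : l11 R) f (c : int -> R) (C : R) :
  (forall k, u k = c k * f k) -> (forall k, `|c k| <= C) -> `|u| <= C * `|f|.
Proof.
move=> uE cC; rewrite [`|f|]l11_normE -zsumZ; last exact: l11_weighted_norm.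
rewrite l11_normE; apply: le_zsum; [exact: l11_weighted_norm| |].
  exact/zsummableZ/l11_weighted_norm.
by move=> k; rewrite uE normrM mulrCA ler_wpM2r// mulr_ge0// weight_ge0.
Qed.

Lemma gainl_le g f : `|gainl g f| <= CK * `|g| * `|f|.
Proof. by apply: norm_mul; [exact: gainlE|exact: gain_le]. Qed.

Lemma lossl_le g f : `|lossl g f| <= CK * `|g| * `|f|.
Proof. by apply: norm_mul; [exact: losslE|exact: loss_le]. Qed.

(** A jump changes the weight by at most 1, which is at most the weight itself; hence the factor
    2. *)
Lemma weight_shift (a k : int) : `|a| <= 1 ->
  1 + `|k|%:~R <= 2 * (1 + `|k + a|%:~R) :> R.
Proof.
move=> a1; rewrite -[1 in X in X <= _]/(1%:~R) -[2]/(2%:~R) -[1 in X in _ <= X]/(1%:~R).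
by rewrite -!intrD -intrM ler_int; lia.
Qed.

Let wshift (w : int -> R) (a : int) (u : l11 R) : `|a| <= 1 ->
  (forall k, `|w k| <= 1 + `|k|%:~R) -> zsummable (fun k => w k * u (k + a)).
Proof.
move=> a1 wle; apply: (@zsummable_le _ _
  (fun k => 2 * ((1 + `|k + a|%:~R) * u (k + a)))); last first.
  apply: zsummableZ; exact: (zsummable_shift a (l11_weighted u)).
move=> k; rewrite mulrA !normrM [`|2|]ger0_norm// (ger0_norm (weight_ge0 R _)).
by rewrite ler_wpM2r//; apply: le_trans (wle k) (weight_shift k a1).
Qed.

Definition shiftl (a : int) (u : l11 R) : l11 R := l11_of (fun k => u (k + a)).

Lemma shiftlE (a : int) (u : l11 R) k : `|a| <= 1 -> shiftl a u k = u (k + a).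
Proof.
move=> a1; rewrite /shiftl l11_ofE//; apply: wshift => // j.
by rewrite ger0_norm// weight_ge0.
Qed.

Lemma shiftl_le (a : int) (u : l11 R) : `|a| <= 1 -> `|shiftl a u| <= 2 * `|u|.
Proof.
move=> a1; rewrite [`|u|]l11_normE -zsumZ; last exact: l11_weighted_norm.
rewrite -(zsum_shift a (fun k => 2 * _)) l11_normE.
apply: le_zsum; [exact: l11_weighted_norm| |].
  exact: (zsummable_shift a (zsummableZ 2 (l11_weighted_norm u))).
by move=> k; rewrite shiftlE// mulrA ler_wpM2r// weight_shift.
Qed.

Definition Qop f g : l11 R :=
  shiftl (- 1) (gainl g f) - gainl g f + (shiftl 1 (lossl g f) - lossl g f).

Lemma QopE f g k : Qop f g k =
  gain g (k - 1) * f (k - 1) - gain g k * f k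
  + (loss g (k + 1) * f (k + 1) - loss g k * f k).
Proof.
rewrite -[LHS]/(shiftl (- 1) (gainl g f) k - gainl g f k
   + (shiftl 1 (lossl g f) k - lossl g f k)).
have -> : shiftl (- 1) (gainl g f) k = gainl g f (k - 1) by exact: shiftlE.
have -> : shiftl 1 (lossl g f) k = lossl g f (k + 1) by exact: shiftlE.
by rewrite 2!gainlE 2!losslE.
Qed.

Lemma Qop_collision2 f g : Qop f g = collision2 K f g :> (int -> R).
Proof. by apply/funext => k; rewrite QopE collision2E. Qed.

(** Each jump direction costs 2 for its shifted copy and 1 for the other one, so 6 in all. *)
Lemma Qop_le f g : `|Qop f g| <= 6 * CK * `|f| * `|g|.
Proof.
have h1 := gainl_le g f; have h2 := lossl_le g f.
have h3 : `|shiftl (- 1) (gainl g f)| <= 2 * `|gainl g f| by exact: shiftl_le.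
have h4 : `|shiftl 1 (lossl g f)| <= 2 * `|lossl g f| by exact: shiftl_le.
apply: le_trans (ler_normD _ _) _.
apply: le_trans (lerD (ler_normB _ _) (ler_normB _ _)) _.
rewrite (_ : 6 * CK * _ * _ = 6 * (CK * `|g| * `|f|)); last by ring.
move: h1 h2 h3 h4; move: (CK * `|g| * `|f|) (`|gainl g f|) (`|lossl g f|).
by move: (`|shiftl _ (gainl g f)|) (`|shiftl _ (lossl g f)|) => a b N c d; lra.
Qed.

Lemma Qop_linearl g : linear (Qop^~ g).
Proof.
move=> a f f'; apply: l11_ext => k.
rewrite -[RHS]/(a * Qop f g k + Qop f' g k) !QopE.
have E j : (a *: f + f') j = a * f j + f' j by [].
by rewrite !E; ring.
Qed.

Lemma Qop_linearr f : linear (Qop f).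
Proof.
move=> a g g'; apply: l11_ext => k.
rewrite -[RHS]/(a * Qop f g k + Qop f g' k) !QopE.
have Eg j : gain (a *: g + g') j = a * gain g j + gain g' j by exact: gain_linear.
have El j : loss (a *: g + g') j = a * loss g j + loss g' j by exact: loss_linear.
by rewrite !Eg !El; ring.
Qed.

(* Summation by parts: each jump contributes an increment of [w]. *)
Lemma zsum_Qop (w : int -> R) f g : (forall k, `|w k| <= 1 + `|k|%:~R) ->
  zsum (fun k => w k * Qop f g k) =
  zsum (fun k => (w (k + 1) - w k) * (gain g k * f k))
  + zsum (fun k => (w (k - 1) - w k) * (loss g k * f k)).
Proof.
move=> wle; have wS (a : int) (u : l11 R) : `|a| <= 1 ->
  zsummable (fun k => w k * u (k + a)) by move=> a1; exact: wshift.
have w0 (u : l11 R) : zsummable (fun k => w k * u k).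
  by have := wS 0 u isT; under [X in zsummable X]funext do rewrite addr0.
have wS' (a : int) (u : l11 R) : `|a| <= 1 -> zsummable (fun k => w (k - a) * u k).
  move=> a1; have := zsummable_shift (- a) (wS a u a1).
  by under [X in zsummable X]funext do rewrite subrK.
have shE (a : int) (u : l11 R) :
    zsum (fun k => w k * u (k + a)) = zsum (fun k => w (k - a) * u k).
  rewrite -(zsum_shift (- a)) /=; congr zsum; apply/funext => k.
  by rewrite subrK.
set u := gainl g f; set v := lossl g f.
have -> : (fun k => w k * Qop f g k) =
  (fun k => (w k * u (k + - 1) - w k * u k) + (w k * v (k + 1) - w k * v k)).
  by apply/funext => k; rewrite QopE /u /v 2!gainlE 2!losslE; ring.
rewrite zsumD; [|apply: zsummableB => //; exact: wS..].
rewrite !zsumB//; [|exact: wS..].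
rewrite (shE (- 1) u) (shE 1 v).
congr (_ + _).
  rewrite -(zsumB (wS' (- 1) u isT) (w0 u)); congr zsum; apply/funext => k.
  by rewrite gainlE opprK mulrBl.
rewrite -(zsumB (wS' 1 v isT) (w0 v)); congr zsum; apply/funext => k.
by rewrite losslE mulrBl.
Qed.

(** The constant weight 1 has no increments, so mass is preserved off the diagonal [f = g] too. *)
Lemma mass_Qop f g : l11_mass (Qop f g) = 0.
Proof.
rewrite /l11_mass; have -> : (Qop f g : int -> R) = (fun k => 1 * Qop f g k).
  by apply/funext => k; rewrite mul1r.
rewrite (@zsum_Qop (fun=> 1)); last by move=> k; rewrite normr1 weight_ge1.
have z (u : int -> R) : zsum (fun k => (1 - 1) * u k) = 0.
  by rewrite -[RHS](zsum0 R); congr zsum; apply/funext => k; rewrite subrr mul0r.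
by rewrite 2!z addr0.
Qed.

(** The weight [k] has increments 1 and -1. The two sums need not agree for [f] different from [g];
    they are exchanged when the arguments are swapped. *)
Lemma charge_Qop f g : l11_charge (Qop f g) =
  zsum (fun k => gain g k * f k) - zsum (fun k => loss g k * f k).
Proof.
rewrite /l11_charge zsum_Qop; last by move=> k; rewrite intr_norm lerDr.
rewrite -zsumN; last first.
  under [X in zsummable X]funext do rewrite -losslE; exact: l11_summable.
congr (zsum _ + zsum _); apply/funext => k; first by rewrite intrD addrAC subrr add0r mul1r.
by rewrite intrB addrAC subrr add0r mulN1r.
Qed.

(** Both sides add [K l k * g l * f k] over all pairs, in the two orders: in a collision one
    particle jumps up exactly when its partner jumps down. *)
Lemma gain_loss_exchange f g : (forall k, 0 <= f k) -> (forall k, 0 <= g k) ->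
  zsum (fun k => gain g k * f k) = zsum (fun k => loss f k * g k).
Proof.
move=> f0 g0; pose a k l := K l k * g l * f k.
have aE1 k : (fun l => a k l) = (fun l => f k * (K l k * g l)).
  by apply/funext => l; rewrite /a mulrC.
have aE2 l : (fun k => a k l) = (fun k => g l * (K l k * f k)).
  by apply/funext => k; rewrite /a; ring.
have s1 k : zsum (a k) = gain g k * f k.
  by rewrite -[a k]/(fun l => a k l) aE1 zsumZ// mulrC.
have s2 l : zsum (a^~ l) = loss f l * g l by rewrite aE2 zsumZ// mulrC.
have sg : zsummable (fun k => gain g k * f k).
  under [X in zsummable X]funext do rewrite -gainlE; exact: l11_summable.
have sl : zsummable (fun k => loss f k * g k).
  under [X in zsummable X]funext do rewrite -losslE; exact: l11_summable.
have := @zsum_exchange _ a.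
under [X in zsum X = _]funext do rewrite s1.
under [X in _ = zsum X]funext do rewrite s2.
under [X in zsummable X -> _ -> zsum _ = _]funext do rewrite s1.
under [X in zsummable X -> zsum _ = _]funext do rewrite s2.
apply => //.
- by move=> i j; rewrite /a mulr_ge0// mulr_ge0.
- by move=> i; rewrite -[a i]/(fun l => a i l) aE1; exact: zsummableZ.
- by move=> j; rewrite aE2; exact: zsummableZ.
Qed.

Definition Pop f g : l11 R := Qop f g + (2 * CK * l11_mass g) *: f.

Lemma Pop_linearl g : linear (Pop^~ g).
Proof.
move=> a f f'; rewrite /Pop.
have -> := Qop_linearl g a f f'.
rewrite (scalerDr _ (a *: f)) scalerA (mulrC _ a) addrACA.
by rewrite (scalerDr a (Qop f g)) scalerA.
Qed.

Lemma Pop_linearr f : linear (Pop f).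
Proof.
move=> a g g'; rewrite /Pop Qop_linearr.
have -> : l11_mass (a *: g + g') = a * l11_mass g + l11_mass g' by rewrite linearP.
rewrite mulrDr scalerDl (mulrCA _ a) -[(a * _) *: f]scalerA addrACA.
by rewrite (scalerDr a (Qop f g)).
Qed.

(** The negative terms of [Qop] are [f k] times two rates, each at most [CK] times the mass of [g];
    the multiple of [f] added in [Pop] absorbs both. *)
Lemma Pop_ge0 f g k : (forall l, 0 <= f l) -> (forall l, 0 <= g l) ->
  0 <= Pop f g k.
Proof.
move=> f0 g0; rewrite -[Pop f g k]/(Qop f g k + 2 * CK * l11_mass g * f k) QopE.
have h1 := ler_wpM2r (f0 k) (gain_le_mass k g0).
have h2 := ler_wpM2r (f0 k) (loss_le_mass k g0).
have h3 := mulr_ge0 (gain_ge0 (k - 1) g0) (f0 (k - 1)).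
have h4 := mulr_ge0 (loss_ge0 (k + 1) g0) (f0 (k + 1)).
lra.
Qed.

Lemma mass_Pop f g : l11_mass (Pop f g) = 2 * CK * l11_mass g * l11_mass f.
Proof. by rewrite /Pop linearD /= mass_Qop add0r linearZ. Qed.

(** This is what makes existence global. The increments of the weight [1 + |k|] are at most 1, so
    summation by parts bounds the contribution of [Qop] by masses only, and no product of two norms
    appears. *)
Lemma Pop_norm_ge0 f g : (forall k, 0 <= f k) -> (forall k, 0 <= g k) ->
  `|Pop f g| <= 2 * CK * l11_mass g * (`|f| + l11_mass f).
Proof.
move=> f0 g0; rewrite l11_norm_ge0E; last by move=> k; exact: Pop_ge0.
have -> : (fun k => (1 + `|k|%:~R) * Pop f g k) =
   (fun k => (1 + `|k|%:~R) * Qop f g k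
      + 2 * CK * l11_mass g * ((1 + `|k|%:~R) * f k)).
  apply/funext => k; rewrite -[Pop f g k]/(Qop f g k + 2 * CK * l11_mass g * f k).
  ring.
rewrite zsumD; [|exact: l11_weighted|exact/zsummableZ/l11_weighted].
rewrite zsumZ; last exact: l11_weighted.
rewrite -(l11_norm_ge0E f0) mulrDr addrC lerD2l.
rewrite zsum_Qop; last by move=> k; rewrite ger0_norm// weight_ge0.
have bound (c u : int -> R) : zsummable u -> (forall k, `|c k| <= 1) ->
    (forall k, 0 <= u k) -> (forall k, u k <= CK * l11_mass g * f k) ->
    zsum (fun k => c k * u k) <= CK * l11_mass g * l11_mass f.
  move=> su c1 u0 ule; rewrite -[X in _ <= X]zsumZ; last exact: l11_summable.
  apply: le_zsum; [exact: zsummable_mul su|exact/zsummableZ/l11_summable|].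
  move=> k; apply: le_trans (ule k); apply: le_trans (ler_norm _) _.
  by rewrite normrM (ger0_norm (u0 k)) ler_piMl.
have step (k a : int) : `|a| <= 1 ->
    `|1 + `|k + a|%:~R - (1 + `|k|%:~R)| <= 1 :> R.
  move=> a1; rewrite opprD addrACA subrr add0r -intrB -intr_norm.
  by rewrite -[X in _ <= X]/(1%:~R) ler_int; lia.
rewrite (_ : 2 * CK * l11_mass g * l11_mass f
  = CK * l11_mass g * l11_mass f + CK * l11_mass g * l11_mass f); last by ring.
apply: lerD; apply: bound.
- under [X in zsummable X]funext do rewrite -gainlE; exact: l11_summable.
- by move=> k; exact: step.
- by move=> k; rewrite mulr_ge0// gain_ge0.
- by move=> k; rewrite ler_wpM2r// gain_le_mass.
- under [X in zsummable X]funext do rewrite -losslE; exact: l11_summable.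
- by move=> k; exact: step.
- by move=> k; rewrite mulr_ge0// loss_ge0.
- by move=> k; rewrite ler_wpM2r// loss_le_mass.
Qed.

End collision_operator.

(** * Power series with values in a Banach space *)

Section power_series.
Variable R : realType.

(** The power [x ^+ n] is the least of the [n + 1] terms of [1 + x + ... + x^n], a sum bounded by
    the full geometric series. *)
Lemma natS_geometric_le (x : R) (n : nat) : 0 <= x -> x < 1 ->
  n.+1%:R * x ^+ n <= (1 - x)^-1.
Proof.
move=> x0 x1; rewrite -[leRHS]div1r ler_pdivlMr ?subr_gt0//.
have xn m : 0 <= x ^+ m by rewrite exprn_ge0.
suff : n.+1%:R * x ^+ n * (1 - x) <= 1 - x ^+ n.+1.
  by move=> /le_trans; apply; rewrite lerBlDr lerDl.
elim: n => [|n IH]; first by rewrite expr0 expr1 !mul1r.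
have := ler_wpM2l x0 IH.
have := mulr_ge0 (_ : 0 <= 1 - x) (_ : 0 <= 1 - x ^+ n.+1).
rewrite !subr_ge0 (ltW x1) exprn_ile1 ?(ltW x1)// => /(_ isT isT).
rewrite -[n.+2%:R]natr1 !exprS.
move: (x ^+ n) (n.+1%:R) => y N H1 H2; lra.
Qed.

(** With [x] the fourth root of [r], three of the four factors [x ^+ n] absorb the cube and the last
    leaves a geometric series. *)
Lemma cvg_cube_geometric_series (r : R) : 0 <= r -> r < 1 ->
  cvgn (series (fun n => n.+1%:R ^+ 3 * r ^+ n)).
Proof.
move=> r0 r1; pose x := Num.sqrt (Num.sqrt r).
have x0 : 0 <= x by exact: sqrtr_ge0.
have xE : x ^+ 4 = r.
  by rewrite (exprM x 2 2) sqr_sqrtr ?sqrtr_ge0// sqr_sqrtr.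
have x1 : x < 1.
  rewrite ltNge; apply/negP => x1; move: r1.
  by rewrite -xE ltNge exprn_ege1.
pose c := (1 - x)^-1.
have c0 : 0 <= c by rewrite invr_ge0 subr_ge0 ltW.
apply: (@series_le_cvg _ _ (geometric (c ^+ 3) x)).
- by move=> n; rewrite mulr_ge0// exprn_ge0.
- by move=> n /=; rewrite mulr_ge0// exprn_ge0.
- move=> n /=; have -> : n.+1%:R ^+ 3 * r ^+ n = (n.+1%:R * x ^+ n) ^+ 3 * x ^+ n.
    by rewrite -xE [in RHS]exprMn -!exprM -[RHS]mulrA -exprD; congr (_ * _ ^+ _); lia.
  rewrite ler_wpM2r ?exprn_ge0//; apply: lerXn2r.
  + by rewrite nnegrE mulr_ge0// exprn_ge0.
  + by rewrite nnegrE.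
  + exact: natS_geometric_le.
- by apply: is_cvg_geometric_series; rewrite ger0_norm.
Qed.

(** Multiplying by [r ^+ 2] avoids the exponent [n - 2], which is truncated for [n < 2]. The
    remainders satisfy [R_(n+1) = (s + h) R_n + n h^2 s^(n-1)], and [n^2 + n <= (n + 1)^2] closes
    the induction. *)
Lemma exprD_taylor2 (s h r : R) (n : nat) : `|s| <= r -> `|s + h| <= r ->
  `|(s + h) ^+ n - s ^+ n - n%:R * h * s ^+ n.-1| * r ^+ 2 <=
  n%:R ^+ 2 * h ^+ 2 * r ^+ n.
Proof.
move=> sr shr; have r0 : 0 <= r by apply: le_trans sr.
elim: n => [|n IH].
  by rewrite !expr0 mul0r mul0r subr0 subrr normr0 !mul0r expr0n/= !mul0r.
have -> : (s + h) ^+ n.+1 - s ^+ n.+1 - n.+1%:R * h * s ^+ n.+1.-1 =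
  (s + h) * ((s + h) ^+ n - s ^+ n - n%:R * h * s ^+ n.-1)
  + n%:R * h ^+ 2 * s ^+ n.-1.
  case: n {IH} => [|n] /=; first by rewrite !expr0 !expr1; ring.
  by rewrite !exprS -[n.+2%:R]natr1; ring.
(* For [n = 0] the truncated predecessor can break this bound, but there the factor [n%:R] kills the
   term. *)
have sn : `|s ^+ n.-1| * r <= r ^+ n \/ n = 0%N.
  case: n {IH} => [|n]; [by right|left] => /=.
  rewrite normrX exprSr ler_wpM2r//; apply: lerXn2r; by rewrite ?nnegrE.
apply: (@le_trans _ _ (r * (n%:R ^+ 2 * h ^+ 2 * r ^+ n)
   + n%:R * h ^+ 2 * r ^+ n.+1)).
  apply: le_trans (_ : (`|s + h| * (`|(s + h) ^+ n - s ^+ n - n%:R * h * s ^+ n.-1| * r ^+ 2)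
    + n%:R * h ^+ 2 * (`|s ^+ n.-1| * r ^+ 2)) <= _).
    rewrite (mulrA `|s + h|) (mulrA (n%:R * h ^+ 2)) -mulrDl ler_wpM2r ?exprn_ge0//.
    apply: le_trans (ler_normD _ _) _.
    by rewrite !normrM normr_nat -expr2 real_normK ?num_real.
  apply: lerD; first by apply: ler_pM => //; rewrite mulr_ge0// exprn_ge0.
  case: sn => [sn|->]; last by rewrite !mul0r.
  by rewrite ler_wpM2l ?(mulr_ge0 (ler0n _ _) (sqr_ge0 h))// expr2 mulrA exprSr ler_wpM2r.
have hr : 0 <= h ^+ 2 * r ^+ n.+1 by exact: mulr_ge0 (sqr_ge0 h) (exprn_ge0 _ r0).
rewrite [X in X <= _](_ : _ = (n%:R ^+ 2 + n%:R) * (h ^+ 2 * r ^+ n.+1)); last first.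
  by rewrite [r ^+ n.+1]exprS; ring.
rewrite -mulrA ler_wpM2r// -natr1.
by have : 0 <= n%:R :> R by []; nra.
Qed.

End power_series.

Lemma is_derive_quadratic (R : realType) (V : normedModType R) (f : R -> V)
    (x : R) (d : V) (C del : R) : 0 < del ->
  (forall h, `|h| < del -> `|f (x + h) - f x - h *: d| <= C * h ^+ 2) ->
  is_derive x 1 f d.
Proof.
move=> del0 H.
have cv : (fun h => h^-1 *: ((f \o shift x) (h *: (1 : R)) - f x)) @ 0^' --> d.
  apply/cvgrPdist_le => e e0.
  (* The second entry forces [|C| * |h| <= e]; adding 1 keeps the denominator positive. *)
  pose del' := Num.min del (e / (`|C| + 1)).
  have C1 : 0 < `|C| + 1 by rewrite ltr_wpDl.
  have d'0 : 0 < del' by rewrite lt_min del0 divr_gt0.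
  near=> h.
  have h0 : h != 0 by near: h; exact: nbhs_dnbhs_neq.
  have hd : `|h| < del' by near: h; exact: dnbhs0_lt.
  rewrite /= [h *: _]mulr1 (addrC h x) distrC.
  have -> : h^-1 *: (f (x + h) - f x) - d =
      h^-1 *: (f (x + h) - f x - h *: d).
    by rewrite [in RHS]scalerBr scalerA mulVf// scale1r.
  rewrite normrZ normfV ler_pdivrMl ?normr_gt0//.
  move: hd; rewrite lt_min => /andP[hd hd2].
  apply: le_trans (H h hd) _; rewrite -real_normK ?num_real//.
  rewrite mulrC -mulrA ler_wpM2l//.
  move: hd2; rewrite ltr_pdivlMr// => /ltW; apply: le_trans.
  rewrite ler_wpM2l//; apply: le_trans (ler_norm C) _.
  by rewrite lerDl.
by split; [apply/cvg_ex; exists d|exact: cvg_lim].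
Unshelve. all: by end_near.
Qed.

(** * Power series whose coefficients grow at most linearly *)

Section vector_power_series.
Variables (R : realType) (V : completeNormedModType R).
Variables (b : nat -> V) (B : R).
Hypothesis b_le : forall n, `|b n| <= B * n.+1%:R.

Let B_ge0 : 0 <= B.
Proof. by have := b_le 0; rewrite mulr1; apply: le_trans. Qed.

(** One majorant [(n + 1)^2 r^n] covers the three coefficient sequences that occur: powers, their
    derivatives and second-order Taylor remainders. The growth of [b] supplies the third factor
    [n + 1]. *)
Lemma cvg_normed_weighted (c : nat -> R) (D r : R) : 0 <= r -> r < 1 ->
  0 <= D -> (forall n, `|c n| <= D * (n.+1%:R ^+ 2 * r ^+ n)) ->
  cvgn [normed series (fun n => c n *: b n)] /\
  limn [normed series (fun n => c n *: b n)] <=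
    D * (B * limn (series (fun n => n.+1%:R ^+ 3 * r ^+ n))).
Proof.
move=> r0 r1 D0 cD.
pose u n : R := n.+1%:R ^+ 3 * r ^+ n.
have u0 n : 0 <= u n by rewrite mulr_ge0// exprn_ge0.
have cu : cvgn (series u) by exact: cvg_cube_geometric_series.
have le n : `|c n *: b n| <= D * B * u n.
  rewrite normrZ; apply: le_trans (ler_pM _ _ (cD n) (b_le n)) _ => //.
  by rewrite /u le_eqVlt; apply/orP; left; apply/eqP; ring.
have uE : (fun n => D * B * u n) = (D * B) *: u by [].
have cDBu : cvgn (series (fun n => D * B * u n)).
  by rewrite uE; exact: is_cvg_seriesZ.
have cv : cvgn [normed series (fun n => c n *: b n)].
  apply: (@series_le_cvg _ _ (fun n => D * B * u n)) => /=.
  - by move=> n; exact: normr_ge0.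
  - by move=> n; apply: le_trans (le n).
  - exact: le.
  - exact: cDBu.
split => //; have <- : limn (series (fun n => D * B * u n)) =
    D * (B * limn (series u)) by rewrite mulrA uE lim_seriesZ.
apply: ler_lim => //.
by apply: nearW => n; apply: ler_sum => i _; exact: le.
Qed.

Definition vsum (c : nat -> R) : V := limn (series (fun n => c n *: b n)).

Lemma cvg_vsum (c : nat -> R) (D r : R) : 0 <= r -> r < 1 ->
  0 <= D -> (forall n, `|c n| <= D * (n.+1%:R ^+ 2 * r ^+ n)) ->
  series (fun n => c n *: b n) @ \oo --> vsum c.
Proof.
move=> r0 r1 D0 cD; apply: normed_cvg.
by have [] := cvg_normed_weighted r0 r1 D0 cD.
Qed.

Lemma vsum_le (c : nat -> R) (D r : R) : 0 <= r -> r < 1 ->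
  0 <= D -> (forall n, `|c n| <= D * (n.+1%:R ^+ 2 * r ^+ n)) ->
  `|vsum c| <= D * (B * limn (series (fun n => n.+1%:R ^+ 3 * r ^+ n))).
Proof.
move=> r0 r1 D0 cD; have [cv le] := cvg_normed_weighted r0 r1 D0 cD.
exact: le_trans (lim_series_norm cv) le.
Qed.

Let pow_le (s r : R) n : `|s| <= r -> `|s ^+ n| <= 1 * (n.+1%:R ^+ 2 * r ^+ n).
Proof.
move=> sr; have r0 : 0 <= r by apply: le_trans sr.
rewrite mul1r normrX; apply: (@le_trans _ _ (r ^+ n)).
  by apply: lerXn2r; rewrite ?nnegrE.
by rewrite ler_peMl ?exprn_ge0// exprn_ege1// ler1n.
Qed.

Let dpow_le (s r : R) n : 0 < r -> `|s| <= r ->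
  `|n%:R * s ^+ n.-1| <= r^-1 * (n.+1%:R ^+ 2 * r ^+ n).
Proof.
move=> r0 sr; have r0' := ltW r0.
rewrite ler_pdivlMl// normrM normr_nat mulrCA.
case: n => [|n]; first by rewrite mul0r mulr_ge0// exprn_ge0.
rewrite [r ^+ n.+1]exprS /= mulrCA [X in _ <= X]mulrCA ler_wpM2l//.
apply: ler_pM => //.
  by rewrite -natrX ler_nat; nia.
by rewrite normrX; apply: lerXn2r; rewrite ?nnegrE.
Qed.

Lemma cvg_vpower (s : R) : `|s| < 1 ->
  series (fun n => s ^+ n *: b n) @ \oo --> vsum (fun n => s ^+ n).
Proof. by move=> s1; apply: (@cvg_vsum _ 1 `|s|) => // n; exact: pow_le. Qed.

(** The radius [r] must be positive even for [s = 0], because [dpow_le] divides by it, and exceed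
    [|s|] to leave room for increments. *)
Let mid (s : R) : `|s| < 1 -> exists r, [/\ 0 < r, `|s| < r & r < 1].
Proof. by move=> s1; exists ((`|s| + 1) / 2); have := normr_ge0 s; split; lra. Qed.

Lemma cvg_vpower_deriv (s : R) : `|s| < 1 ->
  series (fun n => (n%:R * s ^+ n.-1) *: b n) @ \oo -->
  vsum (fun n => n%:R * s ^+ n.-1).
Proof.
move=> s1; have [r [r0 sr r1]] := mid s1.
apply: (@cvg_vsum _ r^-1 r); rewrite ?invr_ge0 ?(ltW r0)// => n.
by apply: dpow_le => //; exact: ltW.
Qed.

(** Termwise differentiation: the second-order remainders of the powers, summed against [b], stay
    quadratic in [h]. *)
Lemma is_derive_vpower (s : R) : `|s| < 1 ->
  is_derive s 1 (fun s => vsum (fun n => s ^+ n))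
    (vsum (fun n => n%:R * s ^+ n.-1)).
Proof.
move=> s1; have [r [r0 sr r1]] := mid s1.
pose S := limn (series (fun n : nat => n.+1%:R ^+ 3 * r ^+ n)).
(* Here [r ^- 2] comes from the Taylor estimate and [B * S] bounds the majorant series; increments
   below [r - |s|] stay in the disc of radius [r]. *)
apply: (@is_derive_quadratic _ _ _ _ _ (r ^- 2 * (B * S)) (r - `|s|)).
  by rewrite subr_gt0.
move=> h hr.
have shr : `|s + h| <= r by apply: le_trans (ler_normD _ _) _; lra.
have sh1 : `|s + h| < 1 by apply: le_lt_trans r1.
pose c n := (s + h) ^+ n - s ^+ n - n%:R * h * s ^+ n.-1.
have hr2 : 0 <= h ^+ 2 * r ^- 2.
  by apply: mulr_ge0 (sqr_ge0 h) _; rewrite invr_ge0 exprn_ge0// ltW.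
have cB n : `|c n| <= h ^+ 2 * r ^- 2 * (n.+1%:R ^+ 2 * r ^+ n).
  have := exprD_taylor2 n (ltW sr) shr.
  rewrite -ler_pdivlMr ?exprn_gt0// => /le_trans; apply.
  rewrite [X in X <= _](_ : _ = h ^+ 2 * r ^- 2 * (n%:R ^+ 2 * r ^+ n)); last by ring.
  apply: ler_wpM2l hr2 _ _ _.
  rewrite ler_wpM2r ?exprn_ge0 ?(ltW r0)//.
  by apply: lerXn2r; rewrite ?nnegrE// ler_nat.
have -> : vsum (fun n => (s + h) ^+ n) - vsum (fun n => s ^+ n)
    - h *: vsum (fun n => n%:R * s ^+ n.-1) = vsum c.
  apply/esym/cvg_lim => //.
  have -> : series (fun n => c n *: b n) =
     (fun N => series (fun n => (s + h) ^+ n *: b n) N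
        - series (fun n => s ^+ n *: b n) N
        - h *: series (fun n => (n%:R * s ^+ n.-1) *: b n) N).
    apply/funext => N; rewrite /series /= scaler_sumr -!sumrB.
    apply: eq_bigr => n _; rewrite /c !scalerBl scalerA.
    by rewrite mulrCA mulrA.
  apply: cvgB; first by apply: cvgB; exact: cvg_vpower.
  by apply: cvgZl_tmp; exact: cvg_vpower_deriv.
apply: le_trans (vsum_le (ltW r0) r1 hr2 cB) _.
by rewrite -/S le_eqVlt; apply/orP; left; apply/eqP; ring.
Qed.

Lemma cvg_vpower_linear (W : normedModType R) (l : {linear V -> W}) (s : R) :
  continuous l -> `|s| < 1 ->
  series (fun n => s ^+ n *: l (b n)) @ \oo --> l (vsum (fun n => s ^+ n)).
Proof.
move=> lc s1; have -> : series (fun n => s ^+ n *: l (b n)) =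
    l \o series (fun n => s ^+ n *: b n).
  apply/funext => N; rewrite /series /= linear_sum.
  by apply: eq_bigr => n _; rewrite linearZ.
by apply: continuous_cvg (cvg_vpower s1); exact: lc.
Qed.

End vector_power_series.

(** * Gronwall's inequality *)

Lemma is_derive1P (R : realType) (V : normedModType R) (f : R -> V) (t : R) (d : V) :
  is_derive t 1 f d <-> h^-1 *: (f (t + h) - f t) @[h --> 0^'] --> d.
Proof.
have -> : (fun h => h^-1 *: (f (t + h) - f t)) =
    (fun h => h^-1 *: ((f \o shift t) (h *: (1 : R)) - f t)).
  by apply/funext => h /=; rewrite [h *: _]mulr1 (addrC h).
split=> [[df <-]|cv]; first exact: df.
by split; [apply/cvg_ex; exists d|exact: cvg_lim].
Qed.

Lemma is_derive1_continuous (R : realType) (V : normedModType R) (f : R -> V)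
    (t : R) (d : V) : is_derive t 1 f d -> {for t, continuous f}.
Proof.
by move=> [df _]; exact/differentiable_continuous/derivable1_diffP.
Qed.

Lemma is_derive_linear_comp (R : realType) (V W : normedModType R)
    (l : {linear V -> W}) (f : R -> V) (t : R) (d : V) : continuous l ->
  is_derive t 1 f d -> is_derive t 1 (l \o f) (l d).
Proof.
move=> lc /is_derive1P cv; apply/is_derive1P.
have -> : (fun h => h^-1 *: ((l \o f) (t + h) - (l \o f) t)) =
    l \o (fun h => h^-1 *: (f (t + h) - f t)).
  by apply/funext => h /=; rewrite linearZ_LR (linearB l).
by apply: continuous_cvg cv; exact: lc.
Qed.

Lemma is_derive_expRZ (R : realType) (c t : R) :
  is_derive t 1 (fun x => expR (c * x)) (c * expR (c * t)).
Proof.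
have h : is_derive t 1 (c \*: (@id R)) c.
  by apply: is_derive_eq; rewrite [_ *: 1]mulr1.
by apply: (is_derive_eq (is_derive1_comp (is_derive_expR _) h)); rewrite mulrC.
Qed.

(** * Norming functionals on [l11] *)

Section pairing.
Variable R : realType.

Definition pairing (s : seq int) (e : int -> R) (v : l11 R) : R :=
  \sum_(k <- s) e k * ((1 + `|k|%:~R) * v k).

Lemma pairing_linear s e : linear (pairing s e).
Proof.
move=> a u v; rewrite /pairing scaler_sumr -big_split; apply: eq_bigr => k _.
change (e k * ((1 + `|k|%:~R) * (a * u k + v k)) =
  a * (e k * ((1 + `|k|%:~R) * u k)) + e k * ((1 + `|k|%:~R) * v k)).
ring.
Qed.

HB.instance Definition _ s e :=
  GRing.isLinear.Build R (l11 R) R _ (pairing s e) (pairing_linear s e).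

Lemma pairing_le s e v : uniq s -> (forall k, `|e k| <= 1) ->
  `|pairing s e v| <= `|v|.
Proof.
move=> us e1; apply: le_trans (fin_sum_le_l11_norm v us).
apply: le_trans (ler_norm_sum _ _ _) _; apply: ler_sum => k _.
by rewrite !normrM (ger0_norm (weight_ge0 R k)) ler_piMl// mulr_ge0//.
Qed.

(** Pairing with the signs of [v] recovers its finite weighted sums, so explicit functionals
    determine the norm without Hahn-Banach. *)
Lemma l11_norming (v : l11 R) (C : R) :
  (forall l : {linear l11 R -> R}, (forall u, `|l u| <= `|u|) -> l v <= C) ->
  `|v| <= C.
Proof.
move=> H; apply: l11_norm_le => s us.
have := H (pairing s (fun k => Num.sg (v k))) _.
rewrite /= /pairing.
rewrite (eq_bigr (fun k => (1 + `|k|%:~R) * `|v k|)); last first.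
  by move=> k _; rewrite mulrCA -normrEsg.
apply => u; apply: pairing_le => // k.
by rewrite normr_sg; case: (v k == 0); rewrite //= ?lexx ?ler01.
Qed.

End pairing.

Section gronwall.
Variables (R : realType) (V : normedModType R).
Hypothesis norming : forall (v : V) (C : R),
  (forall l : {linear V -> R}, (forall u, `|l u| <= `|u|) -> l v <= C) ->
  `|v| <= C.
Variables (D dD : R -> V) (L T : R).
Hypothesis L_gt0 : 0 < L.
Hypothesis D_derive : forall t, t \in `]0, T[ -> is_derive t 1 D (dD t).
Hypothesis D_cont : {within `[0, T], continuous D}.
Hypothesis dD_le : forall t, t \in `]0, T[ -> `|dD t| <= L * `|D t|.
Hypothesis D0 : D 0 = 0.

Let w (t : R) : R := expR (2 * L * t).

Let dw (t : R) : is_derive t 1 w (2 * L * w t).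
Proof. exact: is_derive_expRZ. Qed.

(** For a functional [l] of norm at most 1, the derivative of [l (D t)] is at most [L * M * w t],
    which is the derivative of [M / 2 * w t] because [w] grows at rate [2 * L]. Comparing from
    [t = 0] replaces a vector-valued integral. *)
Let halve (M : R) : 0 <= M -> (forall t, 0 <= t <= T -> `|D t| <= M * w t) ->
  forall t, 0 <= t <= T -> `|D t| <= M / 2 * w t.
Proof.
move=> M0 HM t /andP[t0 tT]; apply: norming => l l_le.
have lc : continuous l.
  by apply: (@continuous_linear_le _ _ _ _ 1) => u; rewrite mul1r l_le.
pose psi t := M / 2 * w t - l (D t).
have dpsi x : x \in `]0, T[ ->
    is_derive x 1 psi (M / 2 * (2 * L * w x) - l (dD x)).
  move=> xT; apply: (@is_deriveB _ _ _ (fun t => M / 2 * w t) (l \o D)).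
    by apply: is_deriveZ; exact: dw.
  by apply: is_derive_linear_comp => //; exact: D_derive.
have wc : continuous w by move=> x; exact: is_derive1_continuous (dw x).
have cpsi : {within `[0, T], continuous psi}.
  move=> x; apply: cvgB.
    apply: cvgMl_tmp; apply: continuous_subspaceT; exact: wc.
  by apply: continuous_cvg; [exact: lc|exact: D_cont].
have psi0 : psi 0 = M / 2.
  by rewrite /psi D0 linear0 subr0 /w mulr0 expR0 mulr1.
rewrite -subr_ge0 -/(psi t); apply: (@le_trans _ _ (psi 0)).
  by rewrite psi0 divr_ge0.
apply: (ger0_derive1_ndecr _ _ cpsi (lexx 0) t0 tT).
- by move=> x /dpsi [].
- move=> x xT; rewrite derive1E; have [_ ->] := dpsi x xT.
  have x0T : 0 <= x <= T by move: xT; rewrite in_itv/= => /andP[/ltW-> /ltW->].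
  rewrite subr_ge0; apply: le_trans (ler_norm _) _.
  apply: le_trans (l_le _) _; apply: le_trans (dD_le xT) _.
  rewrite (_ : M / 2 * _ = L * (M * w x)); last by field.
  by rewrite ler_wpM2l ?(ltW L_gt0)// HM.
Qed.

Lemma gronwall_eq0 t : 0 <= t <= T -> D t = 0.
Proof.
move=> /andP[t0 tT]; have T0 : 0 <= T by exact: le_trans tT.
have cN : {within `[0, T], continuous (fun t => `|D t|)}.
  by move=> x; apply: cvg_norm; exact: D_cont.
have [c cT cmax] := EVT_max T0 cN.
(* The maximum of the norm starts the induction, since [w] is at least 1; repeated halving then
   drives the bound to 0. *)
pose M n := `|D c| / 2 ^+ n.
have w1 x : 0 <= x -> 1 <= w x.
  by move=> x0; rewrite -expR0 ler_expR mulr_ge0// mulr_ge0// ltW.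
have HM n : forall t, 0 <= t <= T -> `|D t| <= M n * w t.
  elim: n => [x xT|n IH x xT].
    rewrite /M expr0 divr1; apply: le_trans (cmax x _) _; first by rewrite in_itv.
    by rewrite ler_peMr// w1//; case/andP: xT.
  have -> : M n.+1 = M n / 2 by rewrite /M exprSr invfM mulrA.
  by apply: halve => //; rewrite divr_ge0// exprn_ge0.
apply/eqP; rewrite -normr_le0.
have cv : (fun n => M n * w t) @ \oo --> 0.
  rewrite -[0](mul0r (w t)); apply: cvgMr_tmp.
  have -> : M = geometric `|D c| 2^-1.
    by apply/funext => n; rewrite /M /= exprVn.
  by apply: cvg_geometric; rewrite ger0_norm ?invr_ge0// invf_lt1// ltr1n.
apply: cvgr_to_ge cv _; apply: nearW => n; apply: HM.
by rewrite t0.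
Qed.

End gronwall.

(** * Bilinear maps, Cauchy products, derivation rules *)

Section bilinear_diagonal.
Variables (R : realType) (V W : normedModType R) (B : V -> V -> W) (C : R).
Hypothesis B_linearl : forall v, linear (B^~ v).
Hypothesis B_linearr : forall u, linear (B u).
Hypothesis B_le : forall u v, `|B u v| <= C * `|u| * `|v|.

Let bilinear0l v : B 0 v = 0.
Proof. by have := B_linearl v (-1) 0 0; rewrite scaler0 addr0 scaleN1r addNr. Qed.

Let bilinear0r u : B u 0 = 0.
Proof. by have := B_linearr u (-1) 0 0; rewrite scaler0 addr0 scaleN1r addNr. Qed.

Lemma bilinearZl a u v : B (a *: u) v = a *: B u v.
Proof. by have := B_linearl v a u 0; rewrite bilinear0l !addr0. Qed.

Lemma bilinearZr a u v : B u (a *: v) = a *: B u v.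
Proof. by have := B_linearr u a v 0; rewrite bilinear0r !addr0. Qed.

Lemma bilinear_diagB u v : B u u - B v v = B (u - v) u + B v (u - v).
Proof.
have -> : u - v = -1 *: v + u by rewrite scaleN1r addrC.
rewrite (B_linearl u (-1) v u) (B_linearr v (-1) v u) !scaleN1r.
by rewrite (addrC (- B v u)) (addrC (- B v v)) addrA subrK.
Qed.

Lemma bilinear_diagB_le u v : `|B u u - B v v| <= C * (`|u| + `|v|) * `|u - v|.
Proof.
rewrite bilinear_diagB; apply: le_trans (ler_normD _ _) _.
apply: le_trans (lerD (B_le _ _) (B_le _ _)) _.
by rewrite le_eqVlt; apply/orP; left; apply/eqP; ring.
Qed.

Lemma bilinear_diag_continuous : continuous (fun u => B u u).
Proof.
move=> v; apply/cvgrPdist_le => e e0.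
(* Within distance 1 of [v] the sum of the two norms is at most [2 * |v| + 1]; the final 1 makes [c]
   positive. *)
pose c := `|C| * (2 * `|v| + 1) + 1.
have c0 : 0 < c by rewrite ltr_wpDl// mulr_ge0// addr_ge0// mulr_ge0.
near=> u.
have uv1 : `|v - u| <= 1 by near: u; apply: cvgr_dist_le => //; exact: cvg_id.
have uve : `|v - u| <= e / c.
  by near: u; apply: cvgr_dist_le; [exact: cvg_id|rewrite divr_gt0].
have un : `|u| <= `|v| + 1.
  rewrite -[u](subKr v); apply: le_trans (ler_normB _ _) _.
  by rewrite lerD2l.
apply: le_trans (bilinear_diagB_le _ _) _.
apply: (@le_trans _ _ (c * `|v - u|)).
  rewrite ler_wpM2r//; apply: (@le_trans _ _ (`|C| * (`|v| + `|u|))).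
    by rewrite ler_wpM2r ?addr_ge0// ler_norm.
  rewrite /c; have := normr_ge0 C; move: un; move: (`|C|) (`|v|) (`|u|) => x y z.
  by move=> zy x0; nra.
by rewrite mulrC -ler_pdivlMr.
Unshelve. all: by end_near.
Qed.

Lemma bilinear_sum (I : Type) (r : seq I) (u v : I -> V) :
  B (\sum_(i <- r) u i) (\sum_(j <- r) v j) =
  \sum_(i <- r) \sum_(j <- r) B (u i) (v j).
Proof.
have BDl w x y : B (x + y) w = B x w + B y w.
  by have := B_linearl w 1 x y; rewrite !scale1r.
have BDr w x y : B w (x + y) = B w x + B w y.
  by have := B_linearr w 1 x y; rewrite !scale1r.
rewrite (big_morph (B^~ (\sum_(j <- r) v j)) (BDl _) (bilinear0l _)).
by apply: eq_bigr => i _; rewrite (big_morph (B (u i)) (BDr _) (bilinear0r _)).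
Qed.

End bilinear_diagonal.

Section cauchy_product.
Variable R : realType.

(** The side [M] of the enclosing square stays free because both [M = N] and the triangle of size
    [2N] are used below. *)
Lemma triangular_sum (x : nat -> nat -> R) (M N : nat) : (N <= M)%N ->
  \sum_(i < M) \sum_(j < M | (i + j < N)%N) x i j =
  \sum_(n < N) \sum_(i < n.+1) x i (n - i)%N.
Proof.
elim: N => [_|N IH NM].
  by rewrite big_ord0 big1// => i _; rewrite big_pred0.
rewrite big_ord_recr /= -(IH (ltnW NM)).
rewrite (big_ord_widen _ (fun i => x i (N - i)%N) NM).
rewrite [X in _ = _ + X]big_mkcond -big_split /=.
apply: eq_bigr => i _; case: ifPn => [iN|].
  have jM : (N - i < M)%N by apply: leq_ltn_trans NM; exact: leq_subr.
  rewrite (bigD1 (Ordinal jM))/=; last by lia.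
  rewrite addrC; congr (_ + _); apply: eq_bigl => j.
  rewrite -val_eqE /=; lia.
by move=> iN; rewrite addr0; apply: eq_bigl => j; lia.
Qed.

(** The square of side [N] lies between the triangles of sizes [N] and [2N], so nonnegative terms
    allow a squeeze. *)
Lemma cauchy_product_cvg (x : nat -> nat -> R) (l : R) :
  (forall i j, 0 <= x i j) ->
  \sum_(n < N) \sum_(i < n.+1) x i (n - i)%N @[N --> \oo] --> l ->
  \sum_(i < N) \sum_(j < N) x i j @[N --> \oo] --> l.
Proof.
move=> x0 cT; pose T N := \sum_(n < N) \sum_(i < n.+1) x i (n - i)%N.
have cT2 : T (N + N)%N @[N --> \oo] --> l.
  apply/cvgrPdist_lt => e e0; have /cvgrPdist_lt/(_ e e0) := cT.
  move=> [n0 _ H]; exists n0 => // n /= nn; apply: H => /=.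
  by rewrite (leq_trans nn)// leq_addr.
apply: squeeze_cvgr cT cT2; apply: nearW => N; apply/andP; split.
  rewrite -(@triangular_sum x N N)//; apply: ler_sum => i _.
  rewrite big_mkcond /=; apply: ler_sum => j _.
  by case: ifP => // _; exact: x0.
rewrite /T -(@triangular_sum x (N + N) (N + N))//.
have NN : (N <= N + N)%N by rewrite leq_addr.
rewrite (big_ord_widen _ (fun i => \sum_(j < N) x i j) NN).
rewrite [X in X <= _]big_mkcond /=.
apply: ler_sum => i _; case: ifPn => [iN|_]; last exact: sumr_ge0.
rewrite (big_ord_widen _ (fun j => x i j) NN).
rewrite [X in X <= _]big_mkcond [X in _ <= X]big_mkcond /=.
apply: ler_sum => j _; case: ifPn => [jN|_]; last by case: ifP.
by rewrite ifT//; lia.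
Qed.

End cauchy_product.

Section derivation_rules.
Variables (R : realType) (V : normedModType R).

Lemma is_derive_scale (w : R -> R) (f : R -> V) (t dw : R) (df : V) :
  is_derive t 1 w dw -> is_derive t 1 f df ->
  is_derive t 1 (fun x => w x *: f x) (w t *: df + dw *: f t).
Proof.
move=> hw hf; have /is_derive1_continuous cw := hw.
move: hw hf => /is_derive1P hw /is_derive1P hf; apply/is_derive1P.
have -> : (fun h => h^-1 *: (w (t + h) *: f (t + h) - w t *: f t)) =
    (fun h => w (t + h) *: (h^-1 *: (f (t + h) - f t))
       + (h^-1 *: (w (t + h) - w t)) *: f t).
  apply/funext => h; rewrite [h^-1 *: (w _ - _)]/(h^-1 * (w (t + h) - w t)).
  have -> (y : V) : w (t + h) *: (h^-1 *: y) = h^-1 *: (w (t + h) *: y).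
    by rewrite !scalerA mulrC.
  by rewrite -scalerA -scalerDr (scalerBr (w (t + h))) scalerBl addrA subrK.
apply: cvgD; last exact: cvgZr_tmp.
apply: cvgZ => //.
have c0 : t + h @[h --> 0^'] --> t.
  rewrite -[X in _ --> X]addr0; apply: cvgD; [exact: cvg_cst|].
  exact: cvg_within.
exact: (cvg_comp _ _ c0 cw).
Qed.

Lemma is_derive_comp_scalar (f : R -> V) (g : R -> R) (t dg : R) (df : V) :
  is_derive t 1 g dg -> is_derive (g t) 1 f df ->
  is_derive t 1 (f \o g) (dg *: df).
Proof.
move=> [g1 g2] [f1 f2].
have gd : differentiable g t by exact/derivable1_diffP.
have fd : differentiable f (g t) by exact/derivable1_diffP.
have fgd := differentiable_comp gd fd.
split; first exact/derivable1_diffP.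
rewrite deriveE// diff_comp//= (diff1E fd) (diff1E gd) 2!derive1E f2 g2.
by rewrite [_ *: dg]mul1r.
Qed.

End derivation_rules.

(** * The initial value problem *)

Section uniqueness.
Variables (R : realType) (K : int -> int -> R) (CK : R).
Hypothesis CK_gt0 : 0 < CK.
Hypothesis K_ge0 : forall k l : int, 0 <= K k l.
Hypothesis K_le : forall k l : int, K k l <= CK.

Lemma C1_continuous (V : normedModType R) (f df : R -> V) :
  is_C1_derivative f df -> {within `[0, +oo[, continuous f}.
Proof.
move=> [fd f0 _]; apply/continuous_within_itvcyP; split.
  move=> t; rewrite in_itv/= andbT => t0.
  exact: is_derive1_continuous (fd t t0).
(* Continuity at 0 follows from the one-sided difference quotient. At [h = 0] the identity holds
   because the outer factor vanishes. *)
have -> : f = (fun h => h *: (h^-1 *: (f h - f 0)) + f 0) \o id.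
  apply/funext => h /=; have [->|h0] := eqVneq h 0; first by rewrite scale0r add0r.
  by rewrite scalerA mulfV// scale1r subrK.
rewrite /= scale0r add0r -[X in _ --> X]add0r -[X in _ --> X + _](scale0r (df 0)).
apply: cvgD; last exact: cvg_cst.
by apply: cvgZ f0; exact: cvg_within.
Qed.

Lemma C1_bounded (V : normedModType R) (f df : R -> V) (T : R) : 0 <= T ->
  is_C1_derivative f df ->
  exists2 M, 0 <= M & forall t, 0 <= t <= T -> `|f t| <= M.
Proof.
move=> T0 /C1_continuous fc.
have fcT : {within `[0, T], continuous (fun t => `|f t|)}.
  have : {within `[0, T], continuous f}.
    by apply: continuous_subspaceW fc => x; rewrite /= !in_itv/= => /andP[->].
  by move=> fT x; apply: cvg_norm; exact: fT.
have [c _ cmax] := EVT_max T0 fcT.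
by exists `|f c| => // t tT; apply: cmax; rewrite in_itv.
Qed.

Let Qdl v := Qop_linearl K_ge0 K_le v.
Let Qdr u := Qop_linearr K_ge0 K_le u.
Let Ql u v := Qop_le K_ge0 K_le u v.

Lemma solution_unique (f0 : l11 R) (f g : R -> l11 R) :
  is_l11_solution K f0 f -> is_l11_solution K f0 g ->
  forall t, 0 <= t -> g t = f t.
Proof.
move=> [df [fC1 dfE f00]] [dg [gC1 dgE g00]] t t0.
have [Mf Mf0 fM] := C1_bounded t0 fC1.
have [Mg Mg0 gM] := C1_bounded t0 gC1.
(* A Lipschitz constant for [Q] between the two solutions on [[0, t]], from their bounds there; the
   1 keeps it positive if both bounds vanish. *)
have L0 : 0 < 6 * CK * (Mg + Mf) + 1.
  by rewrite ltr_wpDl// mulr_ge0// ?addr_ge0// mulr_ge0// ltW.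
apply/eqP; rewrite -subr_eq0; apply/eqP.
apply: (@gronwall_eq0 R (l11 R) (@l11_norming R) (fun x => g x - f x)
  (fun x => dg x - df x) _ t L0 _ _ _ _ t).
- move=> x; rewrite in_itv/= => /andP[x0 _].
  by apply: is_deriveB; [case: gC1|case: fC1] => + _ _; apply.
- have sub : `[0, t] `<=` `[0, +oo[ by move=> x; rewrite /= !in_itv/= => /andP[->].
  have fc := continuous_subspaceW sub (C1_continuous fC1).
  have gc := continuous_subspaceW sub (C1_continuous gC1).
  by move=> x; apply: cvgB; [exact: gc|exact: fc].
- move=> x; rewrite in_itv/= => /andP[x0 xt].
  have QE (h dh : R -> l11 R) : dh x = collision K (h x) :> (int -> R) ->
      dh x = Qop K (h x) (h x).
    by move=> e; apply/val_inj; rewrite [LHS]e [RHS](Qop_collision2 K_ge0 K_le).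
  rewrite (QE _ _ (dfE x x0)) (QE _ _ (dgE x x0)).
  apply: le_trans (bilinear_diagB_le Qdl Qdr Ql _ _) _.
  rewrite ler_wpM2r//; apply: (@le_trans _ _ (6 * CK * (Mg + Mf))); last first.
    by rewrite lerDl.
  rewrite ler_wpM2l ?mulr_ge0 ?(ltW CK_gt0)//.
  by apply: lerD; [apply: gM|apply: fM]; rewrite (ltW x0) ltW.
- by rewrite f00 g00 subrr.
- by rewrite t0 lexx.
Qed.

End uniqueness.

(** * The Wild sum for positive mass *)

Section wild_sum.
Variables (R : realType) (K : int -> int -> R) (CK : R) (f0 : l11 R).
Hypothesis CK_gt0 : 0 < CK.
Hypothesis K_ge0 : forall k l : int, 0 <= K k l.
Hypothesis K_le : forall k l : int, K k l <= CK.
Hypothesis f0_ge0 : forall k, 0 <= f0 k.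
Hypothesis f0_mass : 0 < l11_mass f0.

Let m := l11_mass f0.
Let lam := 2 * CK * m.
Let lam_gt0 : 0 < lam. Proof. by rewrite mulr_gt0// mulr_gt0. Qed.
Local Notation P := (Pop K CK).

(** Each term depends on all earlier ones, so the list of terms is carried along to keep the
    recursion structural. *)
Fixpoint wild_seq (n : nat) : seq (l11 R) :=
  if n is n'.+1 then
    let s := wild_seq n' in
    rcons s ((n'.+1%:R * lam)^-1 *: \sum_(i < n'.+1) P s`_i s`_(n' - i))
  else [:: f0].

Definition wild n := (wild_seq n)`_n.

Let size_wild n : size (wild_seq n) = n.+1.
Proof. by elim: n => //= n IH; rewrite size_rcons IH. Qed.

Let nth_wild n i : (i <= n)%N -> (wild_seq n)`_i = wild i.
Proof.
elim: n => [|n IH]; first by rewrite leqn0 => /eqP->.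
rewrite leq_eqVlt => /orP[/eqP->//|]; rewrite ltnS => i_n.
by rewrite /= nth_rcons size_wild ltnS i_n IH.
Qed.

Lemma wildS n : wild n.+1 =
  (n.+1%:R * lam)^-1 *: \sum_(i < n.+1) P (wild i) (wild (n - i)%N).
Proof.
rewrite {1}/wild /= nth_rcons size_wild ltnn eqxx; congr (_ *: _).
by apply: eq_bigr => i _; rewrite !nth_wild ?leq_subr// -ltnS.
Qed.

Let avg (l : {linear l11 R -> R}) n :
  l (wild n.+1) = (n.+1%:R * lam)^-1 *
    \sum_(i < n.+1) l (P (wild i) (wild (n - i)%N)).
Proof. by rewrite wildS linearZ linear_sum. Qed.

Let avg_cst (a : R) n : (n.+1%:R * lam)^-1 * (\sum_(i < n.+1) lam * a) = a.
Proof.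
have n0 : n.+1%:R != 0 :> R by rewrite pnatr_eq0.
have l0 : lam != 0 by rewrite gt_eqF.
rewrite sumr_const card_ord -[(lam * a) *+ _]mulr_natl.
by move: (n.+1%:R) n0 => N n0; field; rewrite l0.
Qed.

Let sub_ltn n (i : 'I_n.+1) : (n - i < n.+1)%N.
Proof. by rewrite ltnS leq_subr. Qed.

Lemma wild_ge0 n k : 0 <= wild n k.
Proof.
elim/ltn_ind: n k => -[_ k|n IH k]; first exact: f0_ge0.
rewrite -[wild n.+1 k]/(coord k (wild n.+1)) avg mulr_ge0//.
  by rewrite invr_ge0 mulr_ge0// ltW.
apply: sumr_ge0 => i _; apply: (Pop_ge0 K_ge0 K_le) => l; exact: IH.
Qed.

Lemma wild_mass n : l11_mass (wild n) = m.
Proof.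
elim/ltn_ind: n => -[//|n IH].
rewrite avg -[RHS](avg_cst m n); congr (_ * _); apply: eq_bigr => i _.
by rewrite [LHS](mass_Pop K_ge0 K_le) !IH.
Qed.

(** A single product may change the charge. Its defect is antisymmetric under exchanging [i] and
    [n - i], hence cancels in the sum over [i]. *)
Lemma wild_charge n : l11_charge (wild n) = l11_charge f0.
Proof.
elim/ltn_ind: n => -[//|n IH].
rewrite avg -[RHS](avg_cst _ n); congr (_ * _).
pose F i j := zsum (fun k => loss K (wild i) k * wild j k).
have E (i : 'I_n.+1) : l11_charge (P (wild i) (wild (n - i)%N)) =
    (F i (n - i)%N - F (n - i)%N i) + lam * l11_charge f0.
  rewrite /Pop linearD linearZ /= (charge_Qop K_ge0 K_le).
  rewrite (gain_loss_exchange K_ge0 K_le); [|exact: wild_ge0..].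
  by rewrite wild_mass IH.
rewrite (eq_bigr _ (fun i _ => E i)) big_split /= sumrB.
rewrite [X in X - _](reindex_inj rev_ord_inj) /=.
rewrite -sumrB big1 ?add0r// => i _; rewrite subSS.
by rewrite subKn ?subrr// -ltnS.
Qed.

(** By [Pop_norm_ge0] each product, divided by [lam], adds at most [m] to the norm of its first
    factor, whose index is at most [n]; averaging keeps the bound. *)
Lemma wild_norm n : `|wild n| <= `|f0| + n%:R * m.
Proof.
elim/ltn_ind: n => -[_|n IH]; first by rewrite mul0r addr0.
have n0 : 0 <= (n.+1%:R * lam)^-1 by rewrite invr_ge0 mulr_ge0// ltW.
rewrite wildS normrZ ger0_norm// -[X in _ <= X](avg_cst _ n) ler_wpM2l//.
apply: le_trans (ler_norm_sum _ _ _) _; apply: ler_sum => i _.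
apply: le_trans (Pop_norm_ge0 K_ge0 K_le _ _) _; [exact: wild_ge0..|].
rewrite !wild_mass -/lam ler_wpM2l ?(ltW lam_gt0)//.
apply: le_trans (lerD (IH i (ltn_ord i)) (lexx m)) _.
rewrite -addrA lerD2l -[X in _ + X]mul1r -mulrDl ler_wpM2r ?(ltW f0_mass)//.
by rewrite natr1 ler_nat ltn_ord.
Qed.

Lemma wild_norm_le n : `|wild n| <= (`|f0| + m) * n.+1%:R.
Proof.
apply: le_trans (wild_norm n) _; rewrite mulrDl lerD//.
  by rewrite ler_peMr// ler1n.
by rewrite mulrC ler_wpM2l ?(ltW f0_mass)// ler_nat.
Qed.

Definition wphi (s : R) : l11 R := vsum wild (fun n => s ^+ n).
Definition dwphi (s : R) : l11 R := vsum wild (fun n => n%:R * s ^+ n.-1).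

Lemma wphi_ge0 s k : 0 <= s -> s < 1 -> 0 <= wphi s k.
Proof.
move=> s0 s1; have s1' : `|s| < 1 by rewrite ger0_norm.
have := cvg_vpower_linear wild_norm_le (@coord_continuous R k) s1'.
move=> cv; apply: cvgr_to_ge cv _; apply: nearW => N.
by apply: sumr_ge0 => n _; rewrite [_ *: _]/(s ^+ n * wild n k) mulr_ge0 ?exprn_ge0// wild_ge0.
Qed.

(** The image series is geometric. In [wsol] the exponential prefactor equals [1 - s] and cancels
    the denominator. *)
Let const_functional (l : {linear l11 R -> R}) (a s : R) : continuous l ->
  (forall n, l (wild n) = a) -> 0 <= s -> s < 1 -> l (wphi s) = a / (1 - s).
Proof.
move=> lc la s0 s1; have s1' : `|s| < 1 by rewrite ger0_norm.
have cv := cvg_vpower_linear wild_norm_le lc s1'.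
apply: (cvg_unique _ cv) => //.
have -> : (fun n => s ^+ n *: l (wild n)) = geometric a s.
  by apply/funext => n; rewrite la /= [LHS]mulrC.
exact: cvg_geometric_series.
Qed.

Lemma mass_wphi s : 0 <= s -> s < 1 -> l11_mass (wphi s) = m / (1 - s).
Proof.
by apply: const_functional; [exact: mass_continuous|exact: wild_mass].
Qed.

Lemma charge_wphi s : 0 <= s -> s < 1 ->
  l11_charge (wphi s) = l11_charge f0 / (1 - s).
Proof.
by apply: const_functional; [exact: charge_continuous|exact: wild_charge].
Qed.

Lemma wphi0 : wphi 0 = f0.
Proof.
(* The partial sum at index 0 is empty; from index 1 on it is [f0], because [0 ^+ 0 = 1]. *)
apply: cvg_lim => //; rewrite -(cvg_shiftn 1).
apply: cvg_near_cst; apply: nearW => n.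
rewrite /series /= addn1 big_nat_recl//= expr0 scale1r big1 ?addr0//.
by move=> i _; rewrite expr0n /= scale0r.
Qed.

Let Pdl v := Pop_linearl K_ge0 K_le v.
Let Pdr u := Pop_linearr K_ge0 K_le u.

(** The constant 8 is the 6 of [Qop_le] plus the 2 of the added multiple of [u]. *)
Let P_le u v : `|P u v| <= (8 * CK) * `|u| * `|v|.
Proof.
apply: le_trans (ler_normD _ _) _; rewrite normrZ.
have h : `|2 * CK * l11_mass v| * `|u| <= 2 * CK * `|v| * `|u|.
  rewrite ler_wpM2r// normrM ger0_norm ?mulr_ge0 ?(ltW CK_gt0)//.
  by rewrite ler_wpM2l ?mulr_ge0 ?(ltW CK_gt0)// mass_le.
have h2 := Qop_le K_ge0 K_le u v.
apply: le_trans (lerD h2 h) _.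
by rewrite le_eqVlt; apply/orP; left; apply/eqP; ring.
Qed.

(** The recursion equates the coefficients of [s^n] on the two sides. Working in one coordinate
    makes all terms nonnegative reals, where triangular and square partial sums have the same
    limit. *)
Lemma dwphiE s : 0 <= s -> s < 1 -> lam *: dwphi s = P (wphi s) (wphi s).
Proof.
move=> s0 s1; have s1' : `|s| < 1 by rewrite ger0_norm.
apply: l11_ext => k.
pose x i j := s ^+ i * s ^+ j * coord k (P (wild i) (wild j)).
have x0 i j : 0 <= x i j.
  rewrite /x mulr_ge0 ?mulr_ge0 ?exprn_ge0//.
  by apply: (Pop_ge0 K_ge0 K_le) => l; exact: wild_ge0.
have cT : \sum_(n < N) \sum_(i < n.+1) x i (n - i)%N @[N --> \oo] -->
    lam * coord k (dwphi s).
  have cd : coord k (series (fun n => (n%:R * s ^+ n.-1) *: wild n) N)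
      @[N --> \oo] --> coord k (dwphi s).
    apply: continuous_cvg; first exact: coord_continuous.
    exact: (cvg_vpower_deriv wild_norm_le s1').
  pose v N := lam * coord k (series (fun n => (n%:R * s ^+ n.-1) *: wild n) N).
  have cv : v @ \oo --> lam * coord k (dwphi s) by exact: cvgMl_tmp.
  (* The term [n = 0] of the derivative vanishes, so its partial sums match the triangular ones
     after a shift by one. *)
  rewrite -(cvg_shiftn 1) in cv.
  rewrite (_ : (fun N => _) = (fun N => v (N + 1)%N))//; apply/funext => N.
  apply/esym; rewrite /v /series /= addn1 big_nat_recl//= mul0r scale0r add0r.
  rewrite big_mkord.
  have -> : (\sum_(i < N) (i.+1%:R * s ^+ i) *: wild i.+1) k =
      \sum_(i < N) (i.+1%:R * s ^+ i) * wild i.+1 k.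
    by rewrite -[LHS]/(coord k _) linear_sum; apply: eq_bigr => i _; rewrite linearZ.
  rewrite mulr_sumr; apply: eq_bigr => n _.
  have -> : wild n.+1 k = (n.+1%:R * lam)^-1 *
      \sum_(i < n.+1) coord k (P (wild i) (wild (n - i)%N)) := avg (coord k) n.
  have n0 : n.+1%:R != 0 :> R by rewrite pnatr_eq0.
  have l0 : lam != 0 by rewrite gt_eqF.
  rewrite [LHS](_ : _ = s ^+ n * \sum_(i < n.+1) coord k (P (wild i) (wild (n - i)%N))).
    rewrite mulr_sumr; apply: eq_bigr => i _.
    by rewrite /x -exprD subnKC// -ltnS.
  move: (n.+1%:R) n0 (\sum_(i < n.+1) coord k (P (wild i) (wild (n - i)%N))).
  by move=> c c0 y; field; rewrite l0.
have cS := cauchy_product_cvg x0 cT.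
rewrite [LHS]/(lam * coord k (dwphi s)); apply: (cvg_unique _ cS) => //.
pose S N := series (fun n => s ^+ n *: wild n) N.
have -> : (fun N => \sum_(i < N) \sum_(j < N) x i j) =
    coord k \o (fun u => P u u) \o S.
  apply/funext => N; rewrite -[RHS]/(coord k (P (S N) (S N))).
  have -> : S N = \sum_(i < N) s ^+ i *: wild i by rewrite /S /series /= big_mkord.
  rewrite (bilinear_sum Pdl Pdr) linear_sum; apply: eq_bigr => i _.
  rewrite linear_sum; apply: eq_bigr => j _.
  have -> : P (s ^+ i *: wild i) (s ^+ j *: wild j) =
      (s ^+ i * s ^+ j) *: P (wild i) (wild j).
    by rewrite (bilinearZl Pdl) (bilinearZr Pdr) scalerA.
  by rewrite linearZ.
have cPS : P (S N) (S N) @[N --> \oo] --> P (wphi s) (wphi s).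
  apply: (cvg_comp S (fun u => P u u) (cvg_vpower wild_norm_le s1')).
  exact: (bilinear_diag_continuous Pdl Pdr P_le).
exact: (cvg_comp (fun N => P (S N) (S N)) (coord k) cPS (@coord_continuous R k _)).
Qed.

(** * Return to the time variable *)

Let w (t : R) : R := expR (- lam * t).

Definition wsol (t : R) : l11 R := w t *: wphi (1 - w t).

Let w_gt0 t : 0 < w t. Proof. exact: expR_gt0. Qed.

Let w_le1 t : 0 <= t -> w t <= 1.
Proof. by move=> t0; rewrite -expR0 ler_expR mulNr oppr_le0 mulr_ge0// ltW. Qed.

Let s_ge0 t : 0 <= t -> 0 <= 1 - w t.
Proof. by move=> t0; rewrite subr_ge0 w_le1. Qed.

Let s_lt1 t : 1 - w t < 1.
Proof. by rewrite ltrBlDr ltrDl. Qed.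

Let is_derive_w (t : R) : is_derive t 1 w (- lam * w t).
Proof. exact: is_derive_expRZ. Qed.

Lemma wsol0 : wsol 0 = f0.
Proof. by rewrite /wsol /w mulr0 expR0 subrr wphi0 scale1r. Qed.

Lemma wsol_ge0 t k : 0 <= t -> 0 <= wsol t k.
Proof.
move=> t0; rewrite -[wsol t k]/(w t * wphi (1 - w t) k).
by rewrite mulr_ge0 ?(ltW (w_gt0 t))// wphi_ge0// s_ge0.
Qed.

Lemma mass_wsol t : 0 <= t -> l11_mass (wsol t) = l11_mass f0.
Proof.
move=> t0; rewrite /wsol linearZ /= mass_wphi ?s_ge0// subKr.
by rewrite [LHS]mulrC divfK// gt_eqF.
Qed.

Lemma charge_wsol t : 0 <= t -> l11_charge (wsol t) = l11_charge f0.
Proof.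
move=> t0; rewrite /wsol linearZ /= charge_wphi ?s_ge0// subKr.
by rewrite [LHS]mulrC divfK// gt_eqF.
Qed.

(** The product and chain rules give [- lam f + w^2 P(phi, phi)], that is [P(f, f) - lam f], and
    this is [Q(f, f)] because [f] has mass [m]. The derivative is two-sided even at [t = 0], where
    the series variable is 0, interior to the disc of convergence. *)
Lemma is_derive_wsol (t : R) : 0 <= t ->
  is_derive t 1 wsol (Qop K (wsol t) (wsol t)).
Proof.
move=> t0; have s1 : `|1 - w t| < 1 by rewrite ger0_norm ?s_ge0// s_lt1.
have ds : is_derive t 1 (fun x => 1 - w x) (lam * w t).
  have -> : (fun x => 1 - w x) = (cst 1 : R -> R) - w by [].
  apply: (is_derive_eq (is_deriveB (is_derive_cst _ _ _) (is_derive_w t))).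
  by rewrite mulNr opprK add0r.
have dphi := is_derive_comp_scalar ds (is_derive_vpower wild_norm_le s1).
apply: (is_derive_eq (is_derive_scale (is_derive_w t) dphi)).
rewrite -/(dwphi _) -/(wphi _) /= -/(wphi _).
have QP u : Qop K u u = P u u - (2 * CK * l11_mass u) *: u.
  by rewrite /Pop addrK.
rewrite QP mass_wsol// -/lam {1 2 3}/wsol (bilinearZl Pdl) (bilinearZr Pdr) -dwphiE ?s_ge0//.
rewrite mulNr scaleNr; congr (_ - _); rewrite !scalerA; congr (_ *: _).
by rewrite mulrCA mulrC.
Qed.

End wild_sum.

Lemma is_l11_solutionP (R : realType) (K : int -> int -> R) (CK : R)
    (f0 : l11 R) (f : R -> l11 R) :
  (forall k l : int, 0 <= K k l) -> (forall k l : int, K k l <= CK) ->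
  f 0 = f0 -> (forall t : R, 0 <= t -> is_derive t 1 f (Qop K (f t) (f t))) ->
  is_l11_solution K f0 f.
Proof.
move=> K_ge0 K_le f00 fd; exists (fun t => Qop K (f t) (f t)); split => //; last first.
  by move=> t _; rewrite (Qop_collision2 K_ge0 K_le).
split.
- by move=> t /ltW; exact: fd.
- have /is_derive1P := fd 0 (lexx 0).
  under [X in X @ _]funext do rewrite add0r.
  exact: cvg_dnbhs_at_right.
- apply: continuous_in_subspaceT => t; rewrite inE /= in_itv/= andbT => t0.
  apply: (cvg_comp f (fun u => Qop K u u) (is_derive1_continuous (fd t t0))).
  exact: (bilinear_diag_continuous (Qop_linearl K_ge0 K_le)
    (Qop_linearr K_ge0 K_le) (Qop_le K_ge0 K_le)).
Qed.

Theorem theorem2p7 (R : realType) (K : int -> int -> R) (CK : R)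
    (CK_gt0 : 0 < CK)
    (K_ge0 : forall k l : int, 0 <= K k l)
    (K_le : forall k l : int, K k l <= CK)
    (f0 : l11 R) (f0_ge0 : forall k : int, 0 <= f0 k) :
  exists f : R -> l11 R,
    [/\ is_l11_solution K f0 f,
        forall g : R -> l11 R, is_l11_solution K f0 g ->
          forall t : R, 0 <= t -> g t = f t,
        forall (t : R) (k : int), 0 <= t -> 0 <= f t k,
        forall t : R, 0 <= t -> total_mass (f t) = total_mass f0
      & forall t : R, 0 <= t -> total_charge (f t) = total_charge f0].
Proof.
(* Without positive mass [lam] vanishes and the Wild recursion degenerates; nonnegativity then
   forces [f0 = 0], and the constant function solves the problem. *)
have [m_gt0|m_le0] := ltP 0 (l11_mass f0).
  have sol : is_l11_solution K f0 (wsol K CK f0).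
    apply: (is_l11_solutionP K_ge0 K_le); first exact: wsol0.
    by move=> t; exact: is_derive_wsol.
  exists (wsol K CK f0); split => //.
  - by move=> g; exact: (solution_unique CK_gt0 K_ge0 K_le sol).
  - by move=> t k; apply: wsol_ge0.
  - by move=> t; apply: mass_wsol.
  - by move=> t; apply: charge_wsol.
have f00 : f0 = 0.
  apply: l11_ext; apply: (zsum_eq0 (l11_summable f0) f0_ge0).
  by apply/eqP; rewrite eq_le m_le0 zsum_ge0.
have sol : is_l11_solution K f0 (cst f0).
  apply: (is_l11_solutionP K_ge0 K_le) => // t _.
  have -> : Qop K (cst f0 t) (cst f0 t) = 0; last exact: is_derive_cst.
  apply/eqP; rewrite -normr_le0; apply: le_trans (Qop_le K_ge0 K_le _ _) _.
  by rewrite /cst f00 normr0 mulr0.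
exists (cst f0); split => // g gsol.
exact: (solution_unique CK_gt0 K_ge0 K_le sol gsol).
Qed.
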